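(* Up to isomorphism of loops, there are exactly $767$ code loops of order $128$, exactly $80826$ code loops of order $256$, and exactly $937791557$ code loops of order $512$.
   Context: A loop is a nonempty set $Q$ with a binary operation and an element $1$ such that $x\cdot 1=1\cdot x=x$ for all $x\in Q$ and all left translations $y\mapsto xy$ and right translations $y\mapsto yx$ are bijections of $Q$. Code loops: let $F=\mathbb{F}_2$. For $u=(u_1,\dots,u_n),v=(v_1,\dots,v_n)\in F^n$ let $|u|\in\mathbb{Z}$ be the Hamming weight of $u$ (the number of nonzero coordinates) and let $u\cap v=(u_1v_1,\dots,u_nv_n)$. A doubly even binary code is a linear subspace $V$ of some $F^n$ with $|u|\equiv 0\pmod 4$ for every $u\in V$ (then $|u|/4$, $|u\cap v|/2$, $|u\cap v\cap w|$ are integers for all $u,v,w\in V$). A factor set on $V$ is a map $\theta:V^2\to F$ such that for all $u,v,w\in V$: $\theta(u,u)\equiv |u|/4 \pmod 2$; $\theta(u,v)+\theta(v,u)\equiv |u\cap v|/2\pmod 2$; $\theta(u,v)+\theta(u+v,w)+\theta(v,w)+\theta(u,v+w)\equiv |u\cap v\cap w|\pmod 2$. A code loop is a loop (isomorphic to one) defined on $F\times V$ by $(a,u)(b,v)=(a+b+\theta(u,v),u+v)$, where $V$ is a doubly even binary code and $\theta$ is a factor set on $V$. Associative code loops (groups) are included. *)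

(* Defs.v *)
From HB Require Import structures.
From mathcomp Require Import all_boot all_order all_fingroup all_algebra.

Set Implicit Arguments.
Unset Strict Implicit.
Unset Printing Implicit Defensive.

Import GRing.Theory.

HB.mixin Record UMagma_isLoop Q of UMagma Q := {
  mulg_bijl : forall x : Q, bijective (fun y : Q => (x * y)%g);
  mulg_bijr : forall x : Q, bijective (fun y : Q => (y * x)%g)
}.

#[short(type="loopType")]
HB.structure Definition Loop := {Q of UMagma_isLoop Q & UMagma Q}.

(* Stated on the bare carrier: a loopType comes with no enumeration. *)
Definition has_order (Q : loopType) (m : nat) : Prop :=
  exists f : Q -> 'I_m, bijective f.

(* A multiplicative bijection between loops automatically preserves 1. *)
Definition loop_isog (Q R : loopType) : Prop :=
  exists2 f : Q -> R, bijective f & {morph f : x y / (x * y)%g >-> (x * y)%g}.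

Local Open Scope ring_scope.

Section Codes.
Variable n : nat.
Implicit Types u v w : 'rV['F_2]_n.

Definition hamming_weight u : nat := #|[set i | u 0 i != 0]|.

Definition coord_cap u v : 'rV['F_2]_n := \row_i (u 0 i * v 0 i).

Definition doubly_even (V : {vspace 'rV['F_2]_n}) : Prop :=
  forall u, u \in V -> (4 %| hamming_weight u)%N.

(* The quotients by 4 and by 2 below are exact when V is doubly even. *)
Record factor_set (V : {vspace 'rV['F_2]_n}) := FactorSet {
  theta :> subvs_of V -> subvs_of V -> 'F_2;
  thetaxx : forall u : subvs_of V,
    theta u u = (hamming_weight (vsval u) %/ 4)%:R;
  thetaC : forall u v : subvs_of V,
    theta u v + theta v u
      = (hamming_weight (coord_cap (vsval u) (vsval v)) %/ 2)%:R;
  thetaA : forall u v w : subvs_of V,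
    theta u v + theta (u + v) w + theta v w + theta u (v + w)
      = (hamming_weight (coord_cap (coord_cap (vsval u) (vsval v)) (vsval w)))%:R
}.

End Codes.

(* The carrier mentions th only so that the product can be inferred from the
   type. *)
Definition code_loop n (V : {vspace 'rV['F_2]_n}) (th : factor_set V) : Type :=
  ('F_2 * subvs_of V)%type.

Section CodeLoop.
Variables (n : nat) (V : {vspace 'rV['F_2]_n}) (th : factor_set V).

Definition code_mul (x y : code_loop th) : code_loop th :=
  (x.1 + y.1 + th x.2 y.2, x.2 + y.2).

Definition code_one : code_loop th := (0, 0).

Lemma hamming_weight0 : hamming_weight (0 : 'rV['F_2]_n) = 0%N.
Proof. by apply: eq_card0 => i; rewrite !inE mxE eqxx. Qed.

Lemma coord_cap0r u : coord_cap u (0 : 'rV['F_2]_n) = 0.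
Proof. by apply/rowP => i; rewrite !mxE mulr0. Qed.

Lemma coord_cap0l u : coord_cap (0 : 'rV['F_2]_n) u = 0.
Proof. by apply/rowP => i; rewrite !mxE mul0r. Qed.

Lemma addFF (a : 'F_2) : a + a = 0.
Proof. by case: a => -[|[|//]] ?; apply/val_inj. Qed.

Lemma theta0x u : th 0 u = 0.
Proof.
have th00 : th 0 0 = 0 by rewrite thetaxx linear0 hamming_weight0 div0n.
have := thetaA th 0 0 u.
by rewrite !linear0 !coord_cap0l hamming_weight0 !add0r th00 add0r addFF add0r.
Qed.

Lemma thetax0 u : th u 0 = 0.
Proof.
have th00 : th 0 0 = 0 by rewrite thetaxx linear0 hamming_weight0 div0n.
have := thetaA th u 0 0.
by rewrite !linear0 !coord_cap0r hamming_weight0 !addr0 th00 addr0 addFF add0r.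
Qed.

Lemma code_mul1 : left_id code_one code_mul.
Proof. by case=> a u; rewrite /code_mul /= theta0x !add0r addr0. Qed.

Lemma code_mulr1 : right_id code_one code_mul.
Proof. by case=> a u; rewrite /code_mul /= thetax0 !addr0. Qed.

Lemma code_mul_bijl x : bijective (code_mul x).
Proof.
case: x => a u; exists (fun y => (y.1 - a - th u (y.2 - u), y.2 - u)).
  by case=> b v; rewrite /code_mul /= [u + v]addrC addrK addrAC addrK
                         [a + b]addrC addrK.
by case=> b v; rewrite /code_mul /= [u + _]addrC subrK [a + _]addrC
                       addrAC !subrK.
Qed.

Lemma code_mul_bijr x : bijective (code_mul^~ x).
Proof.
case: x => a u; exists (fun y => (y.1 - a - th (y.2 - u) u, y.2 - u)).
  by case=> b v; rewrite /code_mul /= addrK addrAC !addrK.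
by case=> b v; rewrite /code_mul /= subrK addrAC !subrK.
Qed.

HB.instance Definition _ := Choice.on (code_loop th).
HB.instance Definition _ := hasMul.Build (code_loop th) code_mul.
HB.instance Definition _ :=
  Magma_isUMagma.Build (code_loop th) code_mul1 code_mulr1.
HB.instance Definition _ :=
  UMagma_isLoop.Build (code_loop th) code_mul_bijl code_mul_bijr.

End CodeLoop.

Definition is_code_loop (Q : loopType) : Prop :=
  exists (n : nat) (V : {vspace 'rV['F_2]_n}) (th : factor_set V),
    doubly_even V /\ loop_isog Q (code_loop th).

(* There are exactly N isomorphism classes of code loops of order m, witnessed
   by a system of representatives; uniqueness of i makes the representatives
   pairwise non-isomorphic. *)
(* The count is compared in binary: 937791557 cannot be computed in nat. *)
Definition code_loops_up_to_isog (m : nat) (N : BinNums.N) : Prop :=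
  exists (I : finType) (L : I -> loopType),
    [/\ bin_of_nat #|I| = N,
        forall i : I, has_order (L i) m /\ is_code_loop (L i) &
        forall Q : loopType, has_order Q m -> is_code_loop Q ->
          exists! i : I, loop_isog Q (L i)].

(* Main.v *)
Require Import Defs.
From Stdlib Require Import BinNat.
From Stdlib Require Pnat Nnat.
From mathcomp Require Import all_boot all_order all_fingroup all_algebra.
From mathcomp Require Import ring.

(** A code loop of order [2 ^ (d + 1)] is governed by a single function.
Identify the code with [F_2 ^ d] and let [P u] be [|u| / 4] modulo 2.  The
identity [|u + v| + 2 |u cap v| = |u| + |v|] turns the commutator and associator
conditions on a factor set into the second and third polarizations of [P]
([weight_cap], [weight_cap3]) and makes the third one trilinear, so that [P] is
a Boolean polynomial of degree at most 3 without constant term ([cubic],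
[code_loop_form]).  Every such polynomial arises ([cubic_code_loop]): codes and
factor sets can be added, so it is enough to treat products of three
coordinates.  Two factor sets with the same [P] differ by a symmetric cocycle
that vanishes on the diagonal, and such a cocycle is a coboundary
([sym_cocycle_coboundary]).  An isomorphism of loops preserves the central
copy of [F_2] as soon as [P] is not zero, because the nontrivial element of this
copy is then the only nontrivial square ([forms_equivalent]).  Hence the
isomorphism classes are the orbits of [GL_d(2)] on cubic functions
([isog_forms]).

These orbits are counted by the Cauchy-Frobenius lemma ([orbit_count]), which
asks for representatives and sizes of the conjugacy classes of [GL_d(2)] and for
the number of cubic functions that each representative fixes.  The
representatives are block sums of companion matrices of powers of irreducible
polynomials.  Their completeness is certified by the class equation: kernel
dimensions and traces of polynomials in the matrices show that no two of them
are conjugate ([datum_key_conj]); following the images of basis vectors bounds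
each centralizer from above ([centralizer_le]), hence each class from below; and
these lower bounds already add up to the order of the group, so that they are
exact and nothing is missing ([class_sum]).  What remains is a computation with
lists of Booleans ([count_ok]), in which kernels and spaces of fixed functions
are measured by Gaussian elimination ([count_nullity]). *)

Set Implicit Arguments.
Unset Strict Implicit.
Unset Printing Implicit Defensive.
Import GRing.Theory VectorInternalTheory.

(** * The computation *)

Notation bits := (seq bool).

(** Lists stand for vectors of any length: missing bits are zero. *)
Fixpoint bxor (x y : bits) : bits :=
  match x, y with
  | a :: x', b :: y' => xorb a b :: bxor x' y'
  | [::], _ => y
  | _, [::] => x
  end.

Fixpoint split_heads (rows : seq bits) : seq bits * seq bits :=
  if rows is r :: rows' then
    let: (ones, zeros) := split_heads rows' in
    match r with
    | [::] => (ones, zeros)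
    | true :: r' => (r' :: ones, zeros)
    | false :: r' => (ones, r' :: zeros)
    end
  else ([::], [::]).

(** Elimination, one column at a time: the pivot [p] is the first row whose
    leading bit is set, and a column without pivot leaves its unknown free. *)
Fixpoint nullity (n : nat) (rows : seq bits) : nat :=
  if n is n'.+1 then
    let: (ones, zeros) := split_heads rows in
    if ones is p :: ones' then
      nullity n' ([seq bxor p r | r <- ones'] ++ zeros)
    else (nullity n' zeros).+1
  else 0.

(** The product of the row vector [v] by the matrix with rows [A]. *)
Fixpoint blincomb (n : nat) (v : bits) (A : seq bits) : bits :=
  match v, A with
  | b :: v', r :: A' =>
      if b then bxor r (blincomb n v' A') else blincomb n v' A'
  | _, _ => nseq n false
  end.

Definition bunit (n k : nat) : bits := [seq i == k | i <- iota 0 n].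
Definition bid (n : nat) : seq bits := [seq bunit n k | k <- iota 0 n].
Definition btr (n : nat) (A : seq bits) : seq bits :=
  [seq [seq nth false r j | r <- A] | j <- iota 0 n].

(** Horner evaluation at a matrix of the polynomial whose coefficients, constant
    term first, are the bits of [p].  The recursive value is bound by a [let] so
    that it is computed once and not once for each row. *)
Fixpoint bpeval (n : nat) (p : bits) (A : seq bits) : seq bits :=
  if p is b :: p' then
    let C := bpeval n p' A in
    let B := [seq blincomb n r C | r <- A] in
    if b then [seq bxor x.1 x.2 | x <- zip (bid n) B] else B
  else nseq n (nseq n false).

Definition btrace (n : nat) (A : seq bits) : bool :=
  foldr (fun i => xorb (nth false (nth [::] A i) i)) false (iota 0 n).

(** The values at [v] of all squarefree monomials of degree between 1 and [k]:
    those containing the first variable come first. *)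
Fixpoint monomials (v : bits) (k : nat) : bits :=
  match k, v with
  | k'.+1, b :: v' => b :: [seq b && c | c <- monomials v' k'] ++ monomials v' k
  | _, _ => [::]
  end.

(** Vectors of length [n] and Hamming weight at most [k]. *)
Fixpoint light_vectors (k n : nat) : seq bits :=
  if n is n'.+1 then
    [seq false :: v | v <- light_vectors k n'] ++
    (if k is k'.+1 then [seq true :: v | v <- light_vectors k' n'] else [::])
  else [:: [::]].

(** A cubic function is determined by its values on vectors of weight at most 3
    ([cubic_light_eq0]), so invariance is tested on these vectors only. *)
Definition fix_dim (n : nat) (A : seq bits) : nat :=
  nullity (size (monomials (nseq n false) 3))
    [seq bxor (monomials (blincomb n v A) 3) (monomials v 3) | v <- light_vectors 3 n].

(** Binary digits, least significant first: 11 is the polynomial X^3 + X + 1. *)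
Fixpoint pos_bits (p : BinNums.positive) : bits :=
  match p with
  | BinNums.xH => [:: true]
  | BinNums.xO p => false :: pos_bits p
  | BinNums.xI p => true :: pos_bits p
  end.
Definition N_bits (n : N) : bits := if n is Npos p then pos_bits p else [::].

Fixpoint bpmul (p q : bits) : bits :=
  if p is b :: p' then
    let r := false :: bpmul p' q in if b then bxor q r else r
  else [::].
Definition bpexp (p : bits) (e : nat) : bits := iter e (bpmul p) [:: true].

(** The irreducible polynomials of degree at most 8 other than X. *)
Definition irreducibles : seq bits := map N_bits
  [:: 3; 7; 11; 13; 19; 25; 31; 37; 41; 47; 55; 59; 61; 67; 73; 87; 91; 97; 103;
      109; 115; 117; 131; 137; 143; 145; 157; 167; 171; 185; 191; 193; 203; 211;
      213; 229; 239; 241; 247; 253; 283; 285; 299; 301; 313; 319; 333; 351; 355;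
      357; 361; 369; 375; 379; 391; 395; 397; 415; 419; 425; 433; 445; 451; 463;
      471; 477; 487; 499; 501; 505]%num.

Fixpoint partitions (fuel n m : nat) : seq (seq nat) :=
  if fuel is fuel'.+1 then
    if n is 0 then [:: [::]] else
    flatten [seq [seq k :: l | l <- partitions fuel' (n - k) k]
            | k <- iota 1 (minn n m)]
  else [::].

(** Lists of pairs [(f, e)], standing for elementary divisors [f ^ e] of total
    degree [d].  The exponents that go with the same [f] do not increase, which is
    what makes the centralizer bound below sharp. *)
Fixpoint similarity_types (d : nat) (fs : seq bits) : seq (seq (bits * nat)) :=
  if d is 0 then [:: [::]] else
  if fs is f :: fs' then
    flatten
      [seq flatten [seq [seq [seq (f, e) | e <- l] ++ t
                        | t <- similarity_types (d - n * (size f).-1) fs']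
                   | l <- partitions n.+1 n n]
      | n <- iota 0 (d %/ (size f).-1).+1]
  else [::].

(** The rows, from row [s] on, of the block sum of companion matrices: within a
    block each basis vector is sent to the next one. *)
Fixpoint companions (d s : nat) (t : seq (bits * nat)) : seq bits :=
  if t is (f, e) :: t' then
    let F := bpexp f e in
    let n := (size F).-1 in
    [seq bunit d (s + k) | k <- iota 1 n.-1]
      ++ (nseq s false ++ take n F ++ nseq (d - s - n) false)
      :: companions d (s + n) t'
  else [::].

(** One entry for each basis vector: the first vector of the block of [f ^ e]
    comes with the polynomials [f ^ e] and [f ^ (e - 1)], the others with nothing. *)
Fixpoint block_tests (t : seq (bits * nat)) : seq (option (bits * bits)) :=
  if t is (f, e) :: t' then
    let F := bpexp f e in
    Some (F, bpexp f e.-1) :: nseq (size F).-2 None ++ block_tests t'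
  else [::].

Record datum := Datum { dmx : seq bits; dtests : seq (option (bits * bits)) }.

Definition class_data (d : nat) : seq datum :=
  [seq Datum (companions d 0 t) (block_tests t) | t <- similarity_types d irreducibles].

Definition pow2 (k : nat) : N := iter k N.double 1%num.

Section Steps.
Variables (d : nat) (A : seq bits).

(** At the start of a block, [p] kills the basis vector [k], but [q] does not even
    send it into the span of the preceding basis vectors. *)
Definition step_ok (k : nat) (o : option (bits * bits)) : bool :=
  if o is Some (p, q) then
    ~~ has id (nth [::] (bpeval d p A) k) &&
    has id (drop k (nth [::] (bpeval d q A) k))
  else (0 < k) && (nth [::] A k.-1 == bunit d k).

(** The number of vectors that are killed by [p] and that [q] does not send into
    the span of the first [k] basis vectors. *)
Definition step_bound (k : nat) (o : option (bits * bits)) : N :=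
  if o is Some (p, q) then
    let P := btr d (bpeval d p A) in
    N.sub (pow2 (nullity d P))
          (pow2 (nullity d (P ++ drop k (btr d (bpeval d q A)))))
  else 1%num.

Fixpoint steps_ok (k : nat) (l : seq (option (bits * bits))) : bool :=
  if l is o :: l' then step_ok k o && steps_ok k.+1 l' else true.
Fixpoint steps_bound (k : nat) (l : seq (option (bits * bits))) : N :=
  if l is o :: l' then N.mul (step_bound k o) (steps_bound k.+1 l') else 1%num.

End Steps.

Definition centralizer_bound (d : nat) (x : datum) : N :=
  steps_bound d (dmx x) 0 (dtests x).

Definition datum_ok (d : nat) (x : datum) : bool :=
  [&& size (dmx x) == d, all (fun r => size r == d) (dmx x),
      nullity d (btr d (dmx x)) == 0, size (dtests x) == d
    & steps_ok d (dmx x) 0 (dtests x)].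

(** An irreducible factor of degree above [d / 2] occurs at most once, and is then
    detected by traces. *)
Definition null_tests (d : nat) : seq bits :=
  flatten [seq [seq bpexp f k | k <- iota 1 (d %/ (size f).-1)]
          | f <- irreducibles & ((size f).-1 <= d./2)].

(** Kernel dimensions, and the traces of the odd powers of the matrix, even powers
    having the same traces over [F_2]. *)
Definition datum_key (d : nat) (x : datum) : seq nat :=
  [seq nullity d (btr d (bpeval d p (dmx x))) | p <- null_tests d] ++
  [seq nat_of_bool (btrace d (bpeval d (rcons (nseq i.*2.+1 false) true) (dmx x)))
  | i <- iota 0 d].

Definition N_sum (s : seq N) : N := foldr N.add 0%num s.
Definition GL_order (d : nat) : N :=
  N.mul (pow2 'C(d, 2)) (foldr N.mul 1%num [seq N.pred (pow2 i) | i <- iota 1 d]).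

Definition class_size (d : nat) (x : datum) : N :=
  N.div (GL_order d) (centralizer_bound d x).

(** The last two conditions are the class equation of [GL_d(2)] and the
    Cauchy-Frobenius formula for [C] orbits. *)
Definition count_ok (d : nat) (C : N) : bool :=
  let xs := class_data d in
  [&& all (datum_ok d) xs,
      uniq [seq datum_key d x | x <- xs],
      all (fun x => N.eqb (N.mul (class_size d x) (centralizer_bound d x))
                          (GL_order d)) xs,
      N.eqb (N_sum [seq class_size d x | x <- xs]) (GL_order d)
    & N.eqb (N_sum [seq N.mul (class_size d x) (pow2 (fix_dim d (dmx x)))
                   | x <- xs])
            (N.mul C (GL_order d))].

(** * Elimination counts solutions *)

Fixpoint dot (r x : bits) : bool :=
  match r, x with
  | a :: r', b :: x' => xorb (a && b) (dot r' x')
  | _, _ => false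
  end.

Fixpoint all_bits (n : nat) : seq bits :=
  if n is n'.+1 then
    [seq false :: x | x <- all_bits n'] ++ [seq true :: x | x <- all_bits n']
  else [:: [::]].

Lemma mem_all_bits n x : (x \in all_bits n) = (size x == n).
Proof.
elim: n x => [|n IH] [|b x] //=; rewrite mem_cat.
  by apply/orP => -[] /mapP[].
rewrite eqSS -IH; case: b; rewrite ?(mem_map (fun y z => @congr1 _ _ behead (_ :: y) (_ :: z))).
- by rewrite orbC; case: (x \in _) => //=; apply/mapP => -[].
- by case: (x \in _) => //=; apply/mapP => -[].
Qed.

Lemma all_bits_uniq n : uniq (all_bits n).
Proof.
elim: n => //= n IH; rewrite cat_uniq !map_inj_uniq ?IH ?andbT //=;
  try by move=> x y [].
by apply/hasPn => _ /mapP[x _ ->]; apply/mapP => -[].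
Qed.

Lemma dot_bxor r s x : dot (bxor r s) x = xorb (dot r x) (dot s x).
Proof.
elim: r s x => [|a r IH] [|b s] [|c x] //=; first by case: (xorb _ _).
by rewrite IH; case: a b c (dot r x) (dot s x) => [] [] [] [] [].
Qed.

(** An equation whose leading bit is set determines the first unknown [b]. *)
Lemma split_headsP b x rows :
  all (fun r => ~~ dot r (b :: x)) rows =
  all (fun r => ~~ xorb b (dot r x)) (split_heads rows).1 &&
  all (fun r => ~~ dot r x) (split_heads rows).2.
Proof.
elim: rows => //= r rows ->.
case: (split_heads rows) => o z /=.
by case: r => [|[] r] //=; [rewrite andbA | rewrite andbCA].
Qed.

(** The first unknown is either free, which doubles the number of solutions, or
    determined by the pivot equation, which is then added to the other equations
    that involve it. *)
Lemma count_nullity n rows :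
  count (fun x => all (fun r => ~~ dot r x) rows) (all_bits n) = 2 ^ nullity n rows.
Proof.
elim: n rows => [|n IH] rows /=.
  have -> : all (fun r => ~~ dot r [::]) rows by apply/allP => -[].
  by [].
rewrite count_cat !count_map (eq_count (split_headsP _ ^~ _)).
rewrite [X in _ + X](eq_count (split_headsP _ ^~ _)).
case: (split_heads rows) => [[|p o] z] /=.
  by rewrite IH expnS mul2n addnn.
have countD (T : Type) (a b c : pred T) s :
    (forall x, a x + b x = c x) -> count a s + count b s = count c s.
  by move=> abc; elim: s => //= x s <-; rewrite -abc addnACA.
rewrite -IH; apply: countD => x /=; rewrite all_cat all_map.
rewrite [all (preim _ _) o](eq_all (a2 := fun r => ~~ xorb (dot p x) (dot r x)));
  last by move=> r; rewrite -dot_bxor.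
by case: (dot p x); rewrite ?addn0.
Qed.

Lemma nth_bxor x y i :
  nth false (bxor x y) i = xorb (nth false x i) (nth false y i).
Proof.
elim: x y i => [|a x IH] [|b y] [|i] //=; rewrite ?nth_nil //.
- by case: a.
- by case: (nth _ _ _).
Qed.

Lemma size_bxor x y : size (bxor x y) = maxn (size x) (size y).
Proof. by elim: x y => [|a x IH] [|b y] //=; rewrite ?max0n ?maxn0 // IH maxnSS. Qed.

(** * Binary numbers *)

Lemma nat_of_bin_to_nat (a : N) : nat_of_bin a = N.to_nat a.
Proof.
case: a => //= p; elim: p => [p IH|p IH|] //=; rewrite NatTrec.doubleE -mul2n -multE.
  by rewrite Pnat.Pos2Nat.inj_xI -IH.
by rewrite Pnat.Pos2Nat.inj_xO -IH.
Qed.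

Lemma nat_of_add_bin (a b : N) : nat_of_bin (N.add a b) = nat_of_bin a + nat_of_bin b.
Proof. by rewrite !nat_of_bin_to_nat Nnat.N2Nat.inj_add plusE. Qed.

Lemma nat_of_mul_bin (a b : N) : nat_of_bin (N.mul a b) = nat_of_bin a * nat_of_bin b.
Proof. by rewrite !nat_of_bin_to_nat Nnat.N2Nat.inj_mul multE. Qed.

Lemma nat_of_sub_bin (a b : N) : nat_of_bin (N.sub a b) = nat_of_bin a - nat_of_bin b.
Proof. by rewrite !nat_of_bin_to_nat Nnat.N2Nat.inj_sub minusE. Qed.

Lemma nat_of_pred_bin (a : N) : nat_of_bin (N.pred a) = (nat_of_bin a).-1.
Proof. by rewrite !nat_of_bin_to_nat Nnat.N2Nat.inj_pred. Qed.

Lemma nat_of_pow2 k : nat_of_bin (pow2 k) = 2 ^ k.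
Proof.
elim: k => //= k IH.
by rewrite nat_of_bin_to_nat Nnat.N2Nat.inj_double -nat_of_bin_to_nat IH expnS.
Qed.

Lemma nat_of_N_sum s : nat_of_bin (N_sum s) = \sum_(a <- s) nat_of_bin a.
Proof. by elim: s => [|a s IH]; rewrite ?big_nil // big_cons -IH /= nat_of_add_bin. Qed.

(** * Boolean polynomials *)

Definition monomial_count (n k : nat) : nat := size (monomials (nseq n false) k).
Arguments monomial_count : simpl never.

Lemma size_monomials v k : size (monomials v k) = monomial_count (size v) k.
Proof.
rewrite /monomial_count; elim: v k => [|b v IH] [|k] //=.
by rewrite !size_cat !size_map !IH.
Qed.

Lemma monomial_countS n k :
  monomial_count n.+1 k.+1 = (monomial_count n k + monomial_count n k.+1).+1.
Proof. by rewrite /monomial_count /= size_cat size_map. Qed.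

Lemma dot_cat r s c :
  dot (r ++ s) c = xorb (dot r (take (size r) c)) (dot s (drop (size r) c)).
Proof.
elim: r c => [|a r IH] [|b c] //=; first by case: (s).
by rewrite IH; case: (a && b) (dot r _) (dot s _) => [] [] [].
Qed.

Lemma dot_and b r c : dot [seq b && a | a <- r] c = b && dot r c.
Proof.
elim: r c => [|a r IH] [|e c] //=; rewrite ?andbF // IH.
by case: (b) a e (dot r c) => [] [] [] [].
Qed.

Lemma dot_nseq0 r m : dot r (nseq m false) = false.
Proof. by elim: r m => [|a r IH] [|m] //=; rewrite IH andbF. Qed.

Lemma dot_0l m c : dot (nseq m false) c = false.
Proof. by elim: m c => [|m IH] [|a c] //=; rewrite IH. Qed.

Lemma monomials0 n k : monomials (nseq n false) k = nseq (monomial_count n k) false.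
Proof.
elim: n k => [|n IH] [|k] //; rewrite monomial_countS -[nseq n.+1 _]/(false :: _) /=.
rewrite !IH nseqD; congr (_ :: _ ++ _).
by elim: (monomial_count n k) => //= m ->.
Qed.

Lemma dot_monomials_cons b v k c0 c :
  dot (monomials (b :: v) k.+1) (c0 :: c) =
  xorb (b && xorb c0 (dot (monomials v k) (take (monomial_count (size v) k) c)))
       (dot (monomials v k.+1) (drop (monomial_count (size v) k) c)).
Proof.
rewrite /= dot_cat size_map size_monomials dot_and.
by case: b c0 (dot _ (take _ _)) (dot _ (drop _ _)) => [] [] [] [].
Qed.

Lemma size_light_vectors k n v : v \in light_vectors k n -> size v = n.
Proof.
elim: n k v => [|n IH] k v /=; first by rewrite inE => /eqP ->.
rewrite mem_cat => /orP[/mapP[w wl ->]|] /=; first by rewrite (IH _ _ wl).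
by case: k => // k /mapP[w wl ->] /=; rewrite (IH _ _ wl).
Qed.

Lemma light_vectors0 k n : nseq n false \in light_vectors k n.
Proof. by elim: n k => //= n IH k; rewrite mem_cat map_f ?IH. Qed.

(** Vectors starting with 0 show that the coefficients of the monomials without
    the first variable vanish; then 1 followed by 0s isolates the coefficient of
    that variable alone, and the induction applies to the rest. *)
Lemma monomials_light_free n k c : size c = monomial_count n k ->
  {in light_vectors k n, forall v, ~~ dot (monomials v k) c} -> c = nseq (size c) false.
Proof.
elim: n k c => [|n IH] [|k] [|c0 c] //; rewrite monomial_countS => -[sc] c0P /=.
have st : size (take (monomial_count n k) c) = monomial_count n k.
  by rewrite size_takel // sc leq_addr.
have sd : size (drop (monomial_count n k) c) = monomial_count n k.+1.
  by rewrite size_drop sc addKn.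
have d0 : drop (monomial_count n k) c = nseq (monomial_count n k.+1) false.
  rewrite -[in RHS]sd; apply: (IH k.+1) => // v vl.
  have := c0P (false :: v); rewrite dot_monomials_cons (size_light_vectors vl) /=.
  by rewrite mem_cat map_f // => /(_ isT); case: (dot _ _).
have c0Q v : v \in light_vectors k n ->
    ~~ xorb c0 (dot (monomials v k) (take (monomial_count n k) c)).
  move=> vl; have := c0P (true :: v).
  rewrite dot_monomials_cons (size_light_vectors vl) d0 dot_nseq0.
  rewrite mem_cat [in X in _ || X]map_f // orbT => /(_ isT).
  by case: (xorb c0 _).
have c00 : c0 = false.
  by have := c0Q _ (light_vectors0 k n); rewrite monomials0 dot_0l; case: c0 {c0P c0Q}.
have t0 : take (monomial_count n k) c = nseq (monomial_count n k) false.
  by rewrite -[in RHS]st; apply: (IH k) => // v /c0Q; rewrite c00; case: (dot _ _).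
by rewrite c00 -[in LHS](cat_take_drop (monomial_count n k) c) t0 d0 -nseqD -sc.
Qed.

(** Degree at most [k], in terms of iterated differences. *)
Fixpoint degree_le (k n : nat) (f : bits -> bool) : Prop :=
  if k is k'.+1 then
    forall u, size u = n -> degree_le k' n (fun v => xorb (f (bxor v u)) (f v))
  else forall v, size v = n -> f v = f (nseq n false).

Lemma degree_le_false k n f : degree_le k n.+1 f -> degree_le k n (fun v => f (false :: v)).
Proof.
elim: k f => [|k IH] f /= df; first by move=> v sv; rewrite df //= sv.
by move=> u su; have := df (false :: u); rewrite /= su => /(_ erefl)/IH.
Qed.

(** Write [f (b :: v)] as [f (0 :: v) + b g v]: here [g] is a difference of [f], hence
    of smaller degree, and both parts depend on one variable less. *)
Lemma interpolation n k f : degree_le k n f ->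
  exists2 c, size c = monomial_count n k &
    forall v, size v = n -> f v = xorb (f (nseq n false)) (dot (monomials v k) c).
Proof.
elim: n k f => [|n IH] k f df.
  exists [::]; first by case: k {df}.
  by move=> v /size0nil ->; case: k {df} => [|k]; case: (f _).
case: k df => [|k] df.
  exists [::] => [|v sv]; first by [].
  by rewrite df //=; case: v {sv} => [|? ?]; case: (f _).
have [c2 sc2 fc2] := IH _ _ (degree_le_false df).
have sU : size (true :: nseq n false) = n.+1 by rewrite /= size_nseq.
have [c1 sc1 fc1] := IH _ _ (degree_le_false (df _ sU)).
(* [c0] is the coefficient of the first variable alone. *)
set c0 := xorb (f (bxor (false :: nseq n false) (true :: nseq n false)))
               (f (false :: nseq n false)) in fc1; clearbody c0.
exists (c0 :: c1 ++ c2); first by rewrite /= size_cat sc1 sc2 monomial_countS.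
move=> [|b v] // [sv]; rewrite dot_monomials_cons sv.
rewrite take_size_cat // drop_size_cat // [nseq _ _]/=.
have := fc2 v sv; have := fc1 v sv; rewrite /=.
have -> : bxor v (nseq n false) = v.
  elim: v n sv {IH f df c2 sc2 fc2 sU c1 sc1 fc1 c0} => [|a v IHv] [|n] //= [sv].
  by rewrite IHv //; case: a.
move: (dot (monomials v k) c1) (dot (monomials v k.+1) c2) => x1 x2.
by case: b => /=; case: c0 x1 x2 (f (true :: v)) (f (false :: v))
  (f (false :: nseq n false)) {fc1} => [] [] [] [] [] [].
Qed.

(** * Sums of class functions *)

Section ClassSum.
Local Open Scope group_scope.
Variables (gT : finGroupType) (G : {group gT}) (I : finType).
Variables (r : I -> gT) (m : I -> nat).
Hypothesis rG : forall i, r i \in G.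
Hypothesis r_conj : forall i j, r j \in r i ^: G -> i = j.
Hypothesis m_le : forall i, m i <= #|r i ^: G|.
Hypothesis m_sum : (\sum_i m i)%N = #|G|.

(** No element lies in two of the classes, so the classes have at most [#|G|]
    elements together; as the lower bounds [m] add up to [#|G|], they are exact and
    the classes cover [G]. *)
Lemma class_sum (F : gT -> nat) :
  (forall a b, b \in G -> F (a ^ b) = F a) ->
  (\sum_(a in G) F a = \sum_i m i * F (r i))%N.
Proof.
move=> FJ; pose c a := #|[set i | a \in r i ^: G]|.
have c_le a : c a <= 1.
  apply/card_le1_eqP => i j; rewrite !inE => ai aj.
  by apply: r_conj; rewrite -(class_eqP aj) class_sym.
have sum_c f : (\sum_i \sum_(a in r i ^: G) f a = \sum_(a in G) c a * f a)%N.
  rewrite (exchange_big_dep (mem G)) /= => [|i a _ ai]; last first.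
    by case/imsetP: ai => b bG ->; rewrite groupJ.
  by apply: eq_bigr => a _; rewrite /c -sum_nat_const; apply: eq_bigl => i; rewrite inE.
have sum_card : (\sum_i #|r i ^: G| = \sum_(a in G) c a)%N.
  have := sum_c (fun=> 1%N); under eq_bigr do rewrite sum1_card.
  by move=> ->; apply: eq_bigr => a _; rewrite muln1.
have m_le_sum : #|G| <= \sum_(a in G) c a.
  by rewrite -sum_card -m_sum; apply: leq_sum.
have /leqifP := leqif_sum (fun (a : gT) (_ : a \in G) => leqif_eq (c_le a)).
rewrite sum1_card ltnNge m_le_sum; case: ifP => // /forall_inP c1 /eqP c_sum.
have /leqifP := leqif_sum (fun i (_ : true) => leqif_eq (m_le i)).
rewrite sum_card c_sum m_sum ltnn; case: ifP => // /forall_inP m_eq _.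
transitivity (\sum_(a in G) c a * F a)%N.
  by apply: eq_bigr => a /c1/eqP ->; rewrite mul1n.
rewrite -sum_c; apply: eq_bigr => i _; rewrite (eqP (m_eq i isT)) -sum_nat_const.
by apply: eq_bigr => a /imsetP[b bG ->]; rewrite FJ.
Qed.
End ClassSum.

Local Open Scope ring_scope.

(** * Vectors and matrices over the field with two elements *)

Lemma F2_cases (x : 'F_2) : x = 0 \/ x = 1.
Proof. by case: x => -[|[|//]] i; [left|right]; apply/val_inj. Qed.

Lemma F2_eqb (x : 'F_2) : (x != 0)%:R = x.
Proof. by case: (F2_cases x) => ->. Qed.

Lemma F2_boolK (b : bool) : (b%:R != 0 :> 'F_2) = b.
Proof. by case: b. Qed.

Lemma F2_xor (a b : bool) : (xorb a b)%:R = a%:R + b%:R :> 'F_2.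
Proof. by case: a b => [] []; apply/val_inj. Qed.

Lemma F2_and (a b : bool) : (a && b)%:R = a%:R * b%:R :> 'F_2.
Proof. by case: a b => [] []; apply/val_inj. Qed.

Lemma F2_neqD (x y : 'F_2) : (x + y != 0) = xorb (x != 0) (y != 0).
Proof. by rewrite -[x]F2_eqb -[y]F2_eqb -F2_xor !F2_boolK. Qed.

Lemma dotE n r x : size x = n ->
  (dot r x)%:R = \sum_(i < n) (nth false r i)%:R * (nth false x i)%:R :> 'F_2.
Proof.
elim: x n r => [|b x IH] [|n] // r; first by rewrite big_ord0; case: r.
move=> [sx]; case: r => [|a r] /=.
  by rewrite big1 // => i _; rewrite nth_nil mul0r.
by rewrite F2_xor F2_and (IH n) // big_ord_recl.
Qed.

Definition row_of_bits n (v : bits) : 'rV['F_2]_n := \row_i (nth false v i)%:R.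
Definition mx_of_bits n (A : seq bits) : 'M['F_2]_n :=
  \matrix_(i, j) (nth false (nth [::] A i) j)%:R.
Definition bits_of_row n (v : 'rV['F_2]_n) : bits := [seq v 0 i != 0 | i <- enum 'I_n].

Lemma size_bits_of_row n (v : 'rV_n) : size (bits_of_row v) = n.
Proof. by rewrite size_map size_enum_ord. Qed.

Lemma nth_bits_of_row n (v : 'rV_n) (i : 'I_n) : nth false (bits_of_row v) i = (v 0 i != 0).
Proof. by rewrite (nth_map i) ?nth_ord_enum // size_enum_ord. Qed.

Lemma bits_of_rowK n (v : 'rV_n) : row_of_bits n (bits_of_row v) = v.
Proof. by apply/rowP => i; rewrite mxE nth_bits_of_row F2_eqb. Qed.

Lemma row_of_bitsK n (v : bits) : size v = n -> bits_of_row (row_of_bits n v) = v.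
Proof.
move=> sv; apply: (@eq_from_nth _ false); first by rewrite size_bits_of_row.
move=> i; rewrite size_bits_of_row => ltin.
by rewrite (nth_bits_of_row _ (Ordinal ltin)) mxE F2_boolK.
Qed.

Lemma bits_of_row_inj n : injective (@bits_of_row n).
Proof. exact: can_inj (@bits_of_rowK n). Qed.

Lemma row_of_bits_bxor n x y : row_of_bits n (bxor x y) = row_of_bits n x + row_of_bits n y.
Proof. by apply/rowP => i; rewrite !mxE nth_bxor F2_xor. Qed.

Lemma card_bits n (P : pred bits) :
  #|[set v : 'rV['F_2]_n | P (bits_of_row v)]| = count P (all_bits n).
Proof.
rewrite cardE /enum_mem size_filter -enumT.
transitivity (count P [seq bits_of_row v | v <- enum {: 'rV['F_2]_n}]).
  by rewrite count_map; apply: eq_count => v; rewrite /= inE.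
apply/seq.permP/uniq_perm; rewrite ?all_bits_uniq //.
  by rewrite map_inj_uniq ?enum_uniq //; apply: bits_of_row_inj.
move=> x; rewrite mem_all_bits; apply/mapP/eqP => [[v _ ->]|sx]; first exact: size_bits_of_row.
by exists (row_of_bits n x); rewrite ?mem_enum ?row_of_bitsK.
Qed.

Lemma dot_bits_of_row n r (v : 'rV['F_2]_n) :
  (dot r (bits_of_row v))%:R = \sum_(i < n) (nth false r i)%:R * v 0 i :> 'F_2.
Proof.
rewrite (dotE _ (size_bits_of_row v)); apply: eq_bigr => i _.
by rewrite nth_bits_of_row F2_eqb.
Qed.

Lemma size_btr n A : size (btr n A) = n.
Proof. by rewrite size_map size_iota. Qed.

Lemma nth_btr n A i j : (i < n)%N ->
  nth false (nth [::] (btr n A) i) j = nth false (nth [::] A j) i.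
Proof.
move=> ltin; rewrite (nth_map 0%N) ?size_iota // nth_iota // add0n.
case: (ltnP j (size A)) => [ltjA|leAj]; first by rewrite (nth_map [::]).
by rewrite !(nth_default _ leAj) nth_nil nth_default // size_map.
Qed.

Lemma dot_btr n A (v : 'rV['F_2]_n) (i : 'I_n) :
  (dot (nth [::] (btr n A) i) (bits_of_row v))%:R = (v *m mx_of_bits n A) 0 i.
Proof.
by rewrite dot_bits_of_row mxE; apply: eq_bigr => j _; rewrite nth_btr // !mxE mulrC.
Qed.

(** The equations that the columns of [A] from [k] on impose on [v]. *)
Lemma drop_btrP n A k (v : 'rV['F_2]_n) :
  all (fun r => ~~ dot r (bits_of_row v)) (drop k (btr n A)) =
  [forall i : 'I_n, (k <= i)%N ==> ((v *m mx_of_bits n A) 0 i == 0)].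
Proof.
apply/(all_nthP [::])/forallP => [H i|H i].
  apply/implyP => leki; rewrite -dot_btr.
  have := H (i - k)%N; rewrite size_drop size_btr ltn_sub2r ?(leq_ltn_trans leki) //.
  by rewrite nth_drop subnKC // => /(_ isT)/negPf ->.
rewrite size_drop size_btr nth_drop => ltik.
have ltki : (k + i < n)%N by rewrite -ltn_subRL.
have := H (Ordinal ltki); rewrite -dot_btr /= leq_addr /=.
by rewrite -[X in ~~ X]F2_boolK negbK.
Qed.

Lemma btrP n A (v : 'rV['F_2]_n) :
  all (fun r => ~~ dot r (bits_of_row v)) (btr n A) = (v *m mx_of_bits n A == 0).
Proof.
rewrite -[btr n A]drop0 drop_btrP.
apply/forallP/eqP => [H|-> i]; last by rewrite mxE eqxx.
by apply/rowP => i; have /eqP -> := H i; rewrite mxE.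
Qed.

Lemma card_kernel n A :
  #|[set v : 'rV['F_2]_n | v *m mx_of_bits n A == 0]| = (2 ^ nullity n (btr n A))%N.
Proof. by rewrite -count_nullity -card_bits; apply: eq_card => v; rewrite !inE btrP. Qed.

Lemma row_of_bits_nil n : row_of_bits n [::] = 0.
Proof. by apply/rowP => i; rewrite !mxE nth_nil. Qed.

Lemma row_of_bits_nseq0 n m : row_of_bits n (nseq m false) = 0.
Proof. by apply/rowP => i; rewrite !mxE nth_nseq if_same. Qed.

Lemma row_of_bits_blincomb_sum n m v A : (size v <= m)%N ->
  row_of_bits n (blincomb n v A) = \sum_(i < m) (nth false v i)%:R *: row_of_bits n (nth [::] A i).
Proof.
elim: v A m => [|b v IH] A m /=.
  by move=> _; rewrite row_of_bits_nseq0 big1 // => i _; rewrite nth_nil scale0r.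
case: m => // m; rewrite ltnS => lvm; case: A => [|r A] /=.
  by rewrite row_of_bits_nseq0 big1 // => i _; rewrite nth_nil row_of_bits_nil scaler0.
rewrite big_ord_recl /= -(IH A m lvm).
by case: b; rewrite ?row_of_bits_bxor ?scale1r ?scale0r ?add0r.
Qed.

Lemma row_mx_of_bits n A (i : 'I_n) : row i (mx_of_bits n A) = row_of_bits n (nth [::] A i).
Proof. by apply/rowP => j; rewrite !mxE. Qed.

Lemma row_of_bits_blincomb n v A : (size v <= n)%N ->
  row_of_bits n (blincomb n v A) = row_of_bits n v *m mx_of_bits n A.
Proof.
move=> sv; rewrite (row_of_bits_blincomb_sum _ _ sv) mulmx_sum_row.
by apply: eq_bigr => i _; rewrite mxE row_mx_of_bits.
Qed.

Lemma size_blincomb n v A : all (fun r => size r == n) A -> size (blincomb n v A) = n.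
Proof.
elim: v A => [|b v IH] [|r A] //=; rewrite ?size_nseq // => /andP[/eqP sr sA].
by case: b; rewrite ?size_bxor IH ?sr ?maxnn.
Qed.

Lemma bits_of_row_mulmx n A (v : 'rV_n) : all (fun r => size r == n) A ->
  bits_of_row (v *m mx_of_bits n A) = blincomb n (bits_of_row v) A.
Proof.
move=> sA; rewrite -[RHS](@row_of_bitsK n) ?size_blincomb //.
rewrite row_of_bits_blincomb ?size_bits_of_row //.
by rewrite bits_of_rowK.
Qed.

(** The counterpart of [bpeval] on matrices. *)
Fixpoint mpeval n (p : bits) (M : 'M['F_2]_n) : 'M['F_2]_n :=
  if p is b :: p' then b%:R%:M + M *m mpeval p' M else 0.

Lemma mx_of_bits_bpeval n p A : size A = n -> all (fun r => size r == n) A ->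
  mx_of_bits n (bpeval n p A) = mpeval p (mx_of_bits n A).
Proof.
move=> sA rA; elim: p => [|b p IH] /=.
  by apply/matrixP => i j; rewrite !mxE nth_nseq ltn_ord nth_nseq ltn_ord.
set C := bpeval n p A; set B := [seq blincomb n r C | r <- A].
have sB : size B = n by rewrite size_map.
have mB : mx_of_bits n B = mx_of_bits n A *m mx_of_bits n C.
  apply/row_matrixP => i; rewrite row_mul !row_mx_of_bits (nth_map [::]) ?sA //.
  by rewrite row_of_bits_blincomb // (eqP (allP rA _ (mem_nth _ _))) ?sA.
rewrite -IH -mB; case: b => /=; last by rewrite raddf0 add0r.
apply/row_matrixP => i; rewrite raddfD /= !row_mx_of_bits (nth_map ([::], [::])); last first.
  by rewrite size_zip size_map size_iota sB minnn.
rewrite nth_zip ?size_map ?size_iota ?sB // row_of_bits_bxor; congr (_ + _).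
apply/rowP => j; rewrite !mxE (nth_map 0%N) ?size_iota // nth_iota // add0n.
by rewrite /bunit (nth_map 0%N) ?size_iota // nth_iota // add0n eq_sym.
Qed.

Lemma btraceE n A : (btrace n A)%:R = \tr (mx_of_bits n A) :> 'F_2.
Proof.
rewrite /btrace /mxtrace.
under eq_bigr do rewrite mxE.
rewrite -(big_mkord xpredT (fun i => (nth false (nth [::] A i) i)%:R)).
rewrite /index_iota subn0.
by elim: (iota 0 n) => [|i s IH]; rewrite ?big_nil // big_cons /= F2_xor IH.
Qed.

(** * Centralizers in the general linear group *)

Lemma nat_of_GL_order n : nat_of_bin (GL_order n.+1) = #|'GL_n.+1['F_2]%g|.
Proof.
rewrite card_GL // card_Fp // /GL_order nat_of_mul_bin nat_of_pow2; congr (_ * _).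
rewrite /index_iota subSS subn0.
elim: (iota 1 n.+1) => [|i s IH]; rewrite ?big_nil // big_cons -IH /=.
by rewrite nat_of_mul_bin nat_of_pred_bin nat_of_pow2 subn1.
Qed.

Lemma mpeval_comm n p (M h : 'M['F_2]_n) :
  h *m M = M *m h -> h *m mpeval p M = mpeval p M *m h.
Proof.
move=> hM; elim: p => [|b p IH] /=; first by rewrite mulmx0 mul0mx.
by rewrite mulmxDr mulmxDl scalar_mxC mulmxA hM -!mulmxA IH.
Qed.

Lemma mpeval_conj n p (M N x y : 'M['F_2]_n) :
  x *m y = 1%:M -> y *m x = 1%:M -> N = y *m M *m x ->
  mpeval p N = y *m mpeval p M *m x.
Proof.
move=> xy yx ->; elim: p => [|b p IH] /=; first by rewrite mulmx0 mul0mx.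
rewrite IH mulmxDr mulmxDl scalar_mxC -[_ *m y *m x]mulmxA yx mulmx1; congr (_ + _).
by rewrite !mulmxA -[y *m M *m x *m y]mulmxA xy mulmx1.
Qed.

Lemma row_of_bits_no_bit n s : ~~ has id s -> row_of_bits n s = 0.
Proof.
move=> /hasPn s0; apply/rowP => j; rewrite !mxE.
case: (ltnP j (size s)) => [js|sj]; last by rewrite nth_default.
by rewrite (negPf (s0 _ (mem_nth _ js))).
Qed.

Lemma size_bpeval n p A : size A = n -> size (bpeval n p A) = n.
Proof.
move=> sA; case: p => [|[] p] /=; rewrite ?size_nseq ?size_map //.
by rewrite size_zip !size_map size_iota sA minnn.
Qed.

Lemma bpeval_rows n p A : size A = n -> all (fun r => size r == n) A ->
  all (fun r => size r == n) (bpeval n p A).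
Proof.
move=> sA rA; elim: p => [|b p IH] /=.
  by apply/allP => r /nseqP[-> _]; rewrite size_nseq.
have rB : all (fun r => size r == n) [seq blincomb n r (bpeval n p A) | r <- A].
  by apply/allP => _ /mapP[r _ ->]; rewrite size_blincomb.
case: b => //; apply/allP => _ /mapP[[x y] xy ->] /=.
have [xI yB] : x \in bid n /\ y \in [seq blincomb n r (bpeval n p A) | r <- A].
  by split; [have := map_f fst xy; rewrite -/unzip1 unzip1_zip|
             have := map_f snd xy; rewrite -/unzip2 unzip2_zip];
  rewrite // !size_map size_iota sA.
case/mapP: xI => k _ ->.
by rewrite size_bxor size_map size_iota (eqP (allP rB _ yB)) maxnn.
Qed.

Section Centralizer.

Variables (n : nat).
Local Notation d := n.+1.

(** Coercing to a matrix through a constant of its own keeps simplification from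
    unfolding products and inverses in the group. *)
Definition glmx (h : {'GL_d['F_2]}) : 'M['F_2]_d := GLval h.

Lemma glmx_inj : injective glmx.
Proof. exact: val_inj. Qed.

Lemma glmxM h k : glmx (h * k)%g = glmx h *m glmx k.
Proof. by []. Qed.

Lemma glmx1 : glmx 1%g = 1%:M.
Proof. by []. Qed.

Lemma glmxK h : glmx h *m glmx h^-1%g = 1%:M.
Proof. by rewrite -glmxM mulgV. Qed.

Lemma glmxVK h : glmx h^-1%g *m glmx h = 1%:M.
Proof. by rewrite -glmxM mulVg. Qed.

Definition gl_of (A : seq bits) : {'GL_d['F_2]} :=
  insubd (1%g : {'GL_d['F_2]}) (mx_of_bits d A).

Lemma gl_ofE A : nullity d (btr d A) = 0%N -> glmx (gl_of A) = mx_of_bits d A.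
Proof.
move=> nul; have := val_insubd (1%g : {'GL_d['F_2]}) (mx_of_bits d A).
suff -> : mx_of_bits d A \is a GRing.unit by [].
rewrite -[_ \is a _]row_free_unit; apply: inj_row_free => v vA.
have /eqP := card_kernel d A; rewrite nul expn0 => /cards1P[w kerE].
have: v \in [set w] by rewrite -kerE inE vA.
have: 0 \in [set w] by rewrite -kerE inE mul0mx.
by rewrite !inE => /eqP -> /eqP ->.
Qed.

Variable A : seq bits.
Hypotheses (sA : size A = d) (rA : all (fun r => size r == d) A).
Hypothesis nulA : nullity d (btr d A) = 0%N.
Local Notation r := (gl_of A).
Local Notation e i := (delta_mx 0 i : 'rV['F_2]_d).

(** Stabilizer chain of the centralizer along the standard basis; it starts at the
    centralizer and ends at the trivial group. *)
Definition fixing (k : nat) : {set {'GL_d['F_2]}} :=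
  [set h in 'C[r]%g | [forall i : 'I_d, (i < k)%N ==> (e i *m glmx h == e i)]].

Lemma fixingP k (h : {'GL_d['F_2]}) :
  reflect ((glmx h *m mx_of_bits d A = mx_of_bits d A *m glmx h) /\
           forall i : 'I_d, (i < k)%N -> e i *m glmx h = e i)
          (h \in fixing k).
Proof.
rewrite inE; apply: (iffP andP) => [[/cent1P hr /forallP H]|[hr H]].
  split; first by rewrite -(gl_ofE nulA); have := congr1 glmx hr; rewrite !glmxM.
  by move=> i ik; have /implyP/(_ ik)/eqP := H i.
split; last by apply/forallP => i; apply/implyP => /H ->.
by apply/cent1P/glmx_inj; rewrite !glmxM gl_ofE.
Qed.

Lemma fixing_div k h h0 : h \in fixing k -> h0 \in fixing k -> (h * h0^-1)%g \in fixing k.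
Proof.
rewrite 3![_ \in fixing k]inE => /andP[hC /forallP hk] /andP[h0C /forallP h0k].
rewrite groupM ?groupV //; apply/forallP => i; apply/implyP => ik.
rewrite glmxM mulmxA (eqP (implyP (hk i) ik)) -{1}(eqP (implyP (h0k i) ik)).
by rewrite -mulmxA glmxK mulmx1.
Qed.

(** The fibres of the map sending [h] to the image of the next basis vector are
    contained in cosets of the next stabilizer. *)
Lemma fixing_step_bound (k : 'I_d) (W : {set 'rV['F_2]_d}) :
  (forall h, h \in fixing k -> e k *m glmx h \in W) ->
  (#|fixing k| <= #|W| * #|fixing k.+1|)%N.
Proof.
move=> HW; rewrite -sum1_card (partition_big (fun h => e k *m glmx h) (mem W)) //=.
rewrite -sum_nat_const; apply: leq_sum => w _.
rewrite sum1dep_card.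
case: (set_0Vmem [set h | (h \in fixing k) && (e k *m glmx h == w)]) => [->|[h0]].
  by rewrite cards0.
rewrite inE => /andP[h0k /eqP h0w].
rewrite -(card_imset _ (mulIg h0^-1%g)); apply: subset_leq_card.
apply/subsetP => y /imsetP[h]; rewrite inE => /andP[hk /eqP hw] ->.
have /fixingP[cH fH] := fixing_div hk h0k.
apply/fixingP; split=> // i; rewrite ltnS leq_eqVlt => /orP[/eqP ik|]; last exact: fH.
have -> : i = k by apply: val_inj.
by rewrite glmxM mulmxA hw -h0w -mulmxA glmxK mulmx1.
Qed.

Lemma row_gl (i : 'I_d) B : e i *m mx_of_bits d B = row_of_bits d (nth [::] B i).
Proof. by rewrite -rowE row_mx_of_bits. Qed.

Lemma tail_fixed (k : nat) (v : 'rV['F_2]_d) (h : 'M['F_2]_d) :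
  (forall i : 'I_d, (k <= i)%N -> v 0 i = 0) ->
  (forall i : 'I_d, (i < k)%N -> e i *m h = e i) -> v *m h = v.
Proof.
move=> v0 hfix; rewrite [v in LHS]row_sum_delta [v in RHS]row_sum_delta.
rewrite mulmx_suml; apply: eq_bigr => i _; rewrite -scalemxAl.
by case: (ltnP i k) => ik; [rewrite hfix | rewrite v0 // !scale0r].
Qed.

(** Inside a block, the basis vector [k] is the image of its predecessor under a
    matrix commuting with [h], so it is fixed automatically.  At the start of a
    block, [h] preserves the kernel of [p] because it commutes with [p], and it
    cannot move the vector to one that [q] sends into the span of the first [k]
    basis vectors, since [h^-1] fixes this span pointwise. *)
Lemma fixing_step (k : 'I_d) o : step_ok d A k o ->
  (#|fixing k| <= nat_of_bin (step_bound d A k o) * #|fixing k.+1|)%N.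
Proof.
case: o => [[p q]|] /=; last first.
  case/andP=> k0 /eqP rowk; rewrite mul1n; apply: subset_leq_card.
  apply/subsetP => h /fixingP[hC hf]; apply/fixingP; split=> // i.
  rewrite ltnS leq_eqVlt => /orP[/eqP ik|]; last exact: hf.
  have ltk1 : (k.-1 < d)%N by rewrite (leq_ltn_trans (leq_pred _)).
  have ek : e i = e (Ordinal ltk1) *m mx_of_bits d A.
    rewrite row_gl /= rowk; apply/rowP => j; rewrite !mxE /=.
    rewrite (nth_map 0%N) ?size_iota // nth_iota // add0n -ik.
    by rewrite -val_eqE.
  by rewrite ek -mulmxA -hC mulmxA hf //= prednK.
case/andP=> pk qk.
set P := bpeval d p A; set Q := bpeval d q A.
have mP : mx_of_bits d P = mpeval p (mx_of_bits d A) by apply: mx_of_bits_bpeval.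
have mQ : mx_of_bits d Q = mpeval q (mx_of_bits d A) by apply: mx_of_bits_bpeval.
pose K := [set v : 'rV['F_2]_d | v *m mx_of_bits d P == 0].
pose W := [set v : 'rV['F_2]_d |
  all (fun s => ~~ dot s (bits_of_row v)) (btr d P ++ drop k (btr d Q))].
have WK : W \subset K by apply/subsetP => v; rewrite !inE all_cat btrP => /andP[].
have -> : nat_of_bin (N.sub (pow2 (nullity d (btr d P)))
      (pow2 (nullity d (btr d P ++ drop k (btr d Q))))) = #|K :\: W|.
  rewrite nat_of_sub_bin !nat_of_pow2 -card_kernel -count_nullity -card_bits.
  by rewrite cardsD (setIidPr WK).
apply: fixing_step_bound => h /fixingP[hC hf]; rewrite !inE.
rewrite all_cat btrP drop_btrP andbC -mulmxA mP mpeval_comm // mulmxA -mP row_gl.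
have -> : row_of_bits d (nth [::] P k) = 0 by apply: row_of_bits_no_bit.
rewrite mul0mx eqxx /= -mulmxA mQ mpeval_comm // mulmxA -mQ row_gl.
apply/negP => /forallP tail0.
have {}tail0 (i : 'I_d) : (k <= i)%N -> (row_of_bits d (nth [::] Q k) *m glmx h) 0 i = 0.
  by move=> ki; have /implyP/(_ ki)/eqP := tail0 i.
have hfV (i : 'I_d) : (i < k)%N -> e i *m glmx h^-1%g = e i.
  by move=> ik; rewrite -{1}(hf i ik) -mulmxA glmxK mulmx1.
have := tail_fixed tail0 hfV; rewrite -mulmxA glmxK mulmx1 => Qh.
case/hasP: qk => b; case/(nthP false) => j; rewrite size_drop nth_drop => jlt <-.
have sQk : size (nth [::] Q k) = d.
  by apply/eqP/(all_nthP [::] (bpeval_rows q sA rA)); rewrite size_bpeval.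
have ltkj : (k + j < d)%N by rewrite -ltn_subRL; move: jlt; rewrite sQk.
have := tail0 (Ordinal ltkj) (leq_addr _ _).
by rewrite -Qh mxE /=; case: nth.
Qed.

Lemma centralizer_le l :
  steps_ok d A 0 l -> size l = d ->
  (#|'C[r]%g| <= nat_of_bin (steps_bound d A 0 l))%N.
Proof.
have -> : 'C[r]%g = fixing 0.
  by apply/setP => h; rewrite [RHS]inE; case: (h \in _) => //=; apply/esym/forallP.
have fix_d : (#|fixing d| <= 1)%N.
  apply: leq_trans (_ : #|[set 1%g : {'GL_d['F_2]}]| <= 1)%N; last by rewrite cards1.
  apply/subset_leq_card/subsetP => h /fixingP[_ hf]; rewrite inE; apply/eqP/glmx_inj.
  by apply/row_matrixP => i; rewrite !rowE hf // glmx1 mulmx1.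
have chain k : (k + size l)%N = d -> steps_ok d A k l ->
    (#|fixing k| <= nat_of_bin (steps_bound d A k l))%N.
  elim: l k => [|o l IH] k /=; first by rewrite addn0 => ->.
  move=> kl /andP[ok1 ok2]; rewrite nat_of_mul_bin.
  have ltkd : (k < d)%N by rewrite -kl addnS ltnS leq_addr.
  apply: leq_trans (fixing_step (k := Ordinal ltkd) ok1) _.
  by rewrite leq_mul2l /= IH ?orbT // addSnnS.
by move=> okl sl; apply: chain.
Qed.

End Centralizer.

(** * The conjugacy classes *)

Section Data.
Variable n : nat.
Local Notation d := n.+1.

Lemma datum_okP x : datum_ok d x ->
  [/\ size (dmx x) = d, all (fun r => size r == d) (dmx x),
     nullity d (btr d (dmx x)) = 0%N, size (dtests x) = d
    & steps_ok d (dmx x) 0 (dtests x)].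
Proof. by case/and5P => /eqP ? ? /eqP ? /eqP ? ?. Qed.

(** Conjugation carries the kernel of a polynomial in one matrix to the kernel of
    the same polynomial in the other, and it preserves traces. *)
Lemma datum_key_conj x y (g : {'GL_d['F_2]}) : datum_ok d x -> datum_ok d y ->
  gl_of n (dmx y) = (gl_of n (dmx x) ^ g)%g -> datum_key d x = datum_key d y.
Proof.
case/datum_okP => sx rx nx _ _ /datum_okP[sy ry ny _ _] conj.
have conjM : mx_of_bits d (dmx y) = glmx g^-1%g *m mx_of_bits d (dmx x) *m glmx g.
  by rewrite -!gl_ofE // conj conjgE -!glmxM mulgA.
have conjp p := mpeval_conj p (glmxK g) (glmxVK g) conjM.
congr (_ ++ _).
  apply: eq_map => p; apply: (@expnI 2) => //; rewrite -!card_kernel !mx_of_bits_bpeval //.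
  have inj : injective (fun v : 'rV['F_2]_d => v *m glmx g).
    by apply: (can_inj (g := fun v => v *m glmx g^-1%g)) => v; rewrite -mulmxA glmxK mulmx1.
  rewrite -(card_imset _ inj); apply: eq_card => w; rewrite !inE conjp !mulmxA.
  apply/imsetP/eqP => [[v] |wK].
    rewrite inE => /eqP vK ->; rewrite -[_ *m glmx g *m _]mulmxA glmxK mulmx1 vK.
    by rewrite mul0mx.
  exists (w *m glmx g^-1%g); last by rewrite -mulmxA glmxVK mulmx1.
  rewrite inE; apply/eqP; have := congr1 (mulmx^~ (glmx g^-1%g)) wK.
  by rewrite mul0mx -[_ *m glmx g *m _]mulmxA glmxK mulmx1.
apply: eq_map => i; congr nat_of_bool.
rewrite -[LHS]F2_boolK -[RHS]F2_boolK !btraceE !mx_of_bits_bpeval // conjp.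
by rewrite mxtrace_mulC mulmxA glmxK mul1mx.
Qed.

(** An upper bound on the centralizer is a lower bound on the class. *)
Lemma class_size_le x : datum_ok d x ->
  N.mul (class_size d x) (centralizer_bound d x) = GL_order d ->
  (nat_of_bin (class_size d x) <= #|(gl_of n (dmx x)) ^: 'GL_d['F_2]|%g)%N.
Proof.
case/datum_okP => sx rx nx st ok eq.
have := congr1 nat_of_bin eq; rewrite nat_of_mul_bin nat_of_GL_order.
set g := gl_of n (dmx x); set c := nat_of_bin (centralizer_bound d x).
rewrite -(Lagrange (subsetIl 'GL_d['F_2] 'C[g])%g) index_cent1 => mc.
have c_ge : (#|'C_('GL_d['F_2])[g]%g| <= c)%N.
  apply: leq_trans (centralizer_le sx rx nx ok st).
  by apply/subset_leq_card/subsetIr.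
have c_gt0 : (0 < c)%N by apply: leq_trans c_ge; apply: cardG_gt0.
by rewrite -(leq_pmul2r c_gt0) mc mulnC leq_mul2l c_ge orbT.
Qed.

Lemma GL_sum xs : all (datum_ok d) xs -> uniq [seq datum_key d x | x <- xs] ->
  all (fun x => N.eqb (N.mul (class_size d x) (centralizer_bound d x)) (GL_order d)) xs ->
  N.eqb (N_sum [seq class_size d x | x <- xs]) (GL_order d) ->
  forall F : {'GL_d['F_2]} -> nat, (forall a b, F (a ^ b)%g = F a) ->
  (\sum_(a in 'GL_d['F_2]%g) F a =
   \sum_(x <- xs) nat_of_bin (class_size d x) * F (gl_of n (dmx x)))%N.
Proof.
have all_tnth (a : pred datum) : all a xs -> forall i, a (tnth (in_tuple xs) i).
  by move=> H; apply/(@all_tnthP _ _ a (in_tuple xs)).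
move=> /all_tnth ok keys /all_tnth ord /N.eqb_eq tot F FJ.
pose X (i : 'I_(size xs)) := tnth (in_tuple xs) i.
rewrite [RHS]big_tnth; apply: (class_sum (G := 'GL_d['F_2]%G) (r := fun i => gl_of n (dmx (X i)))
  (m := fun i => nat_of_bin (class_size d (X i)))).
- by move=> i; rewrite inE.
- move=> i j /imsetP[g _ conj].
  have eq_key : datum_key d (X i) = datum_key d (X j).
    by apply: datum_key_conj conj; apply: ok.
  apply/val_inj/eqP; rewrite -(nth_uniq [::] _ _ keys) ?size_map; [|exact: ltn_ord..].
  have x0 := X i; rewrite !(nth_map x0); [|exact: ltn_ord..].
  by move: eq_key; rewrite /X !(tnth_nth x0) => ->.
- by move=> i; apply: class_size_le; [apply: ok | apply/N.eqb_eq/ord].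
- rewrite -(nat_of_GL_order n) -tot nat_of_N_sum big_map.
  by rewrite [RHS]big_tnth.
- by move=> a b _; apply: FJ.
Qed.

End Data.

(** * Cubic functions *)

Notation F2fun d := {ffun 'rV['F_2]_d -> 'F_2}.

Definition pol2 d (P : F2fun d) u v := P (u + v) + P u + P v.
Definition pol3 d (P : F2fun d) u v w :=
  P (u + v + w) + P (u + v) + P (u + w) + P (v + w) + P u + P v + P w.

Definition cubic d (P : F2fun d) : bool :=
  (P 0 == 0) &&
  [forall u, forall v, forall w, forall t,
     pol3 P (u + v) w t == pol3 P u w t + pol3 P v w t].

Lemma cubicP d (P : F2fun d) :
  reflect (P 0 = 0 /\ forall u v w t, pol3 P (u + v) w t = pol3 P u w t + pol3 P v w t)
          (cubic P).
Proof.
apply: (iffP andP) => -[/eqP P0 H]; split=> //.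
  by move=> u v w t; move/forallP/(_ u)/forallP/(_ v)/forallP/(_ w)/forallP/(_ t)/eqP: H.
by do 4![apply/forallP => ?]; rewrite H.
Qed.

Lemma F2_2 : 2%:R = 0 :> 'F_2. Proof. exact/val_inj. Qed.
Lemma F2_3 : 3%:R = 1 :> 'F_2. Proof. exact/val_inj. Qed.
Lemma F2_4 : 4%:R = 0 :> 'F_2. Proof. exact/val_inj. Qed.
Lemma F2_5 : 5%:R = 1 :> 'F_2. Proof. exact/val_inj. Qed.
Lemma F2_6 : 6%:R = 0 :> 'F_2. Proof. exact/val_inj. Qed.

Lemma F2_opp (x : 'F_2) : - x = x.
Proof. by apply/eqP; rewrite eq_sym -addr_eq0 addFF. Qed.

(** The tactic [ring] does not reduce coefficients modulo 2; the small ones are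
    rewritten explicitly. *)
Ltac F2_ring := rewrite ?F2_opp; ring: F2_2 F2_3 F2_4 F2_5 F2_6.

Lemma cubic0 d : cubic (0 : F2fun d).
Proof. by apply/cubicP; split=> [|u v w t]; rewrite /pol3 !ffunE ?addr0. Qed.

Lemma cubicD d (P Q : F2fun d) : cubic P -> cubic Q -> cubic (P + Q).
Proof.
move=> /cubicP[P0 HP] /cubicP[Q0 HQ]; apply/cubicP; split; first by rewrite ffunE P0 Q0 addr0.
have pol3D u v w : pol3 (P + Q) u v w = pol3 P u v w + pol3 Q u v w.
  rewrite /pol3 !ffunE; ring.
by move=> u v w t; rewrite !pol3D HP HQ; ring.
Qed.

(** Indices may coincide: [x_i x_j x_j] is the quadratic monomial [x_i x_j], and
    [x_i x_i x_i] is [x_i]. *)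
Definition coord3 d (i j k : 'I_d) : F2fun d :=
  [ffun v : 'rV['F_2]_d => v 0 i * v 0 j * v 0 k].

Lemma pol3_coord3 d (i j k : 'I_d) u v w :
  pol3 (coord3 i j k) u v w =
  \sum_(x <- [:: (u, v, w); (u, w, v); (v, u, w); (v, w, u); (w, u, v); (w, v, u)])
     x.1.1 0 i * x.1.2 0 j * x.2 0 k.
Proof.
rewrite /pol3 !big_cons big_nil !ffunE !mxE.
rewrite /=; F2_ring.
Qed.

Lemma cubic_coord3 d (i j k : 'I_d) : cubic (coord3 i j k).
Proof.
apply/cubicP; split=> [|u v w t]; first by rewrite ffunE mxE !mul0r.
rewrite !pol3_coord3 !big_cons !big_nil /= !mxE; ring.
Qed.

Definition coord3_sum d (l : seq ('I_d * 'I_d * 'I_d)) : F2fun d :=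
  \sum_(t <- l) coord3 t.1.1 t.1.2 t.2.

Lemma cubic_coord3_sum d l : cubic (@coord3_sum d l).
Proof.
rewrite /coord3_sum; elim/big_ind: _ => [||t _]; [exact: cubic0|exact: cubicD|].
exact: cubic_coord3.
Qed.

Section Polynomials.
Variable d : nat.

Definition poly_form (c : bits) : F2fun d :=
  [ffun v => (dot (monomials (bits_of_row v) 3) c)%:R].

Let bit (v : 'rV['F_2]_d) (i : 'I_d) := v 0 i != 0.

(** The three lemmas below expand a polynomial of degree 1, 2 or 3, multiplied by
    enough coordinates to reach degree 3, into products of three coordinates. *)
Lemma span1 s (i j : 'I_d) c : exists l, forall v : 'rV['F_2]_d,
  v 0 i * v 0 j * (dot (monomials (map (bit v) s) 1) c)%:R = coord3_sum l v.
Proof.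
elim: s c => [|k s IH] [|c0 c]; try by exists [::] => v; rewrite /coord3_sum big_nil ffunE mulr0.
have [l Hl] := IH (drop (monomial_count (size s) 0) c).
exists (if c0 then (i, j, k) :: l else l) => v.
rewrite dot_monomials_cons size_map F2_xor mulrDr Hl.
have -> : dot (monomials (map (bit v) s) 0) _ = false by case: (map _ _).
case: c0; rewrite ?andbF ?mulr0 ?add0r // andbT F2_eqb.
by rewrite /coord3_sum big_cons !ffunE.
Qed.

Lemma span2 s (i : 'I_d) c : exists l, forall v : 'rV['F_2]_d,
  v 0 i * (dot (monomials (map (bit v) s) 2) c)%:R = coord3_sum l v.
Proof.
elim: s c => [|k s IH] [|c0 c]; try by exists [::] => v; rewrite /coord3_sum big_nil ffunE mulr0.
have [l Hl] := IH (drop (monomial_count (size s) 1) c).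
have [l1 Hl1] := span1 s i k (take (monomial_count (size s) 1) c).
exists ((if c0 then [:: (i, k, k)] else [::]) ++ l1 ++ l) => v.
rewrite dot_monomials_cons size_map F2_xor mulrDr Hl F2_and F2_eqb F2_xor.
rewrite mulrDr mulrDr mulrA [v 0 i * (v 0 k * _)]mulrA Hl1.
rewrite /coord3_sum !big_cat /= !ffunE addrA; congr (_ + _ + _).
case: c0; rewrite ?big_cons big_nil !ffunE ?mulr0 // addr0 mulr1.
by case: (F2_cases (v 0 k)) => ->; rewrite ?mulr0 ?mulr1.
Qed.

Lemma span3 s c : exists l, forall v : 'rV['F_2]_d,
  (dot (monomials (map (bit v) s) 3) c)%:R = coord3_sum l v.
Proof.
elim: s c => [|k s IH] [|c0 c]; try by exists [::] => v; rewrite /coord3_sum big_nil ffunE.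
have [l Hl] := IH (drop (monomial_count (size s) 2) c).
have [l1 Hl1] := span2 s k (take (monomial_count (size s) 2) c).
exists ((if c0 then [:: (k, k, k)] else [::]) ++ l1 ++ l) => v.
rewrite dot_monomials_cons size_map F2_xor Hl F2_and F2_eqb F2_xor.
rewrite mulrDr Hl1.
rewrite /coord3_sum !big_cat /= !ffunE addrA; congr (_ + _ + _).
case: c0; rewrite ?big_cons big_nil !ffunE ?mulr0 // addr0 mulr1.
by case: (F2_cases (v 0 k)) => ->; rewrite ?mulr0 ?mulr1.
Qed.

Lemma poly_form_span c : exists l, poly_form c = coord3_sum l.
Proof.
have [l Hl] := span3 (enum 'I_d) c.
by exists l; apply/ffunP => v; rewrite ffunE -Hl.
Qed.

Lemma cubic_poly_form c : cubic (poly_form c).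
Proof. by have [l ->] := poly_form_span c; apply: cubic_coord3_sum. Qed.

(** Trilinearity of the third polarization says that the fourth differences of [P]
    vanish. *)
Lemma cubic_poly_formP (P : F2fun d) : cubic P ->
  exists2 c, size c = monomial_count d 3 & P = poly_form c.
Proof.
move=> /cubicP[P0 HP].
pose f (v : bits) := P (row_of_bits d v) != 0.
have df : degree_le 3 d f.
  move=> u su w sw t st v sv; rewrite /f.
  rewrite -!F2_neqD !row_of_bits_bxor row_of_bits_nseq0 !add0r; congr (_ != 0).
  move: (row_of_bits d v) (row_of_bits d u) (row_of_bits d w) (row_of_bits d t) => v' u' w' t'.
  apply/eqP; rewrite -subr_eq0; apply/eqP.
  have /eqP := HP v' t' w' u'; rewrite -subr_eq0 => /eqP H.
  rewrite -[RHS]H /pol3 P0; F2_ring.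
have [c sc fc] := interpolation df.
exists c => //; apply/ffunP => v; rewrite ffunE.
have := fc (bits_of_row v) (size_bits_of_row v).
rewrite /f bits_of_rowK row_of_bits_nseq0 P0 eqxx /= => <-.
by rewrite F2_eqb.
Qed.

Lemma poly_form_light_inj c : size c = monomial_count d 3 ->
  {in light_vectors 3 d, forall v, poly_form c (row_of_bits d v) = 0} -> c = nseq (size c) false.
Proof.
move=> sc c0; apply: (monomials_light_free sc) => v vl.
by have := c0 v vl; rewrite ffunE row_of_bitsK ?(size_light_vectors vl) //; case: (dot _ _).
Qed.

Lemma poly_formD c c' : poly_form (bxor c c') = poly_form c + poly_form c'.
Proof.
apply/ffunP => v; rewrite !ffunE -F2_xor; congr (_%:R).
have dotC r s : dot r s = dot s r.
  by elim: r s => [|a r IH] [|b s] //=; rewrite IH andbC.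
by rewrite dotC dot_bxor !(dotC (monomials _ _)).
Qed.

Lemma poly_form_nseq0 m : poly_form (nseq m false) = 0.
Proof. by apply/ffunP => v; rewrite !ffunE dot_nseq0. Qed.

Lemma poly_form_inj : {in [pred c | size c == monomial_count d 3] &, injective poly_form}.
Proof.
move=> c c' /eqP sc /eqP sc' eqP.
have sb : size (bxor c c') = monomial_count d 3 by rewrite size_bxor sc sc' maxnn.
have b0 := poly_form_light_inj sb.
have {}b0 : bxor c c' = nseq (size c) false.
  rewrite b0 ?sb ?sc // => v _; rewrite poly_formD eqP ffunE addFF //.
apply: (@eq_from_nth _ false); first by rewrite sc sc'.
move=> i _; have := nth_bxor c c' i; rewrite b0 nth_nseq if_same.
by case: (nth _ c i) (nth _ c' i) => [] [].
Qed.

(** This reduces an identity between cubic functions to vectors of weight at most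
    3. *)
Lemma cubic_light_eq0 (P : F2fun d) : cubic P ->
  {in light_vectors 3 d, forall v, P (row_of_bits d v) = 0} -> P = 0.
Proof.
move=> /cubic_poly_formP[c sc ->] H.
by rewrite (poly_form_light_inj sc H) poly_form_nseq0.
Qed.

End Polynomials.

(** * Orbits of cubic functions *)

Section Orbits.
Variable n : nat.
Local Notation d := n.+1.
Local Notation GL := 'GL_d['F_2]%G.

Definition form_act (P : F2fun d) (g : {'GL_d['F_2]}) : F2fun d :=
  [ffun v => P (v *m glmx g^-1%g)].

Lemma form_act1 : form_act^~ 1%g =1 id.
Proof. by move=> P; apply/ffunP => v; rewrite ffunE invg1 glmx1 mulmx1. Qed.

Lemma form_actM P : act_morph form_act P.
Proof. by move=> g h; apply/ffunP => v; rewrite !ffunE invMg glmxM mulmxA. Qed.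

Canonical form_action := TotalAction form_act1 form_actM.

Definition cubics : {set F2fun d} := [set P | cubic P].

Lemma cubic_act P g : cubic P -> cubic (form_act P g).
Proof.
move=> /cubicP[P0 HP]; apply/cubicP; split; first by rewrite ffunE mul0mx.
by move=> u v w t; rewrite /pol3 !ffunE !mulmxDl; apply: HP.
Qed.

Lemma GL_acts_cubics : [acts GL, on cubics | form_action].
Proof.
apply/subsetP => g _; rewrite !inE /=; apply/subsetP => P; rewrite !inE.
exact: cubic_act.
Qed.

Lemma form_act_fixP (P : F2fun d) g :
  reflect (forall v, P (v *m glmx g) = P v) (form_act P g == P).
Proof.
apply: (iffP eqP) => [fixP v|fixP]; first by rewrite -{1}fixP ffunE -mulmxA glmxK mulmx1.
by apply/ffunP => v; rewrite ffunE -[in LHS]fixP -mulmxA glmxVK mulmx1.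
Qed.

(** Cubic functions correspond to coefficient vectors, and invariance is a system of
    linear equations in the coefficients. *)
Lemma fix_dim_correct A : size A = d -> all (fun r => size r == d) A ->
  nullity d (btr d A) = 0%N ->
  #|'Fix_(cubics | form_action)[gl_of n A]%g| = (2 ^ fix_dim d A)%N.
Proof.
move=> sA rA nulA; set g := gl_of n A.
rewrite /fix_dim -count_nullity -/(monomial_count d 3).
set Q := fun c => all _ _.
have QP c : reflect
    {in light_vectors 3 d, forall v,
       poly_form d c (row_of_bits d v *m glmx g) = poly_form d c (row_of_bits d v)}
    (Q c).
  rewrite /Q all_map gl_ofE //; apply: (iffP allP) => H v vl; have := H v vl.
    rewrite /= dot_bxor !ffunE bits_of_row_mulmx // row_of_bitsK ?(size_light_vectors vl) //.
    by case: (dot _ c) (dot _ c) => [] [].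
  rewrite /= dot_bxor !ffunE bits_of_row_mulmx // row_of_bitsK ?(size_light_vectors vl) //.
  by case: (dot _ c) (dot _ c) => [] [].
rewrite cardE -size_filter -(size_map (poly_form d)); apply/perm_size/uniq_perm.
- exact: enum_uniq.
- rewrite map_inj_in_uniq ?filter_uniq ?all_bits_uniq // => c c'.
  rewrite !mem_filter !mem_all_bits => /andP[_ sc] /andP[_ sc'].
  exact: poly_form_inj.
move=> P; rewrite mem_enum; apply/setIP/mapP => [[]|[c]].
  rewrite inE => /cubic_poly_formP[c sc ->] /afix1P/eqP/form_act_fixP fixP.
  exists c => //; rewrite mem_filter mem_all_bits sc eqxx andbT.
  by apply/QP => v _; apply: fixP.
rewrite mem_filter => /andP[/QP fixc _] ->; rewrite inE cubic_poly_form; split=> //.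
apply/afix1P/eqP/form_act_fixP => v.
have R0 : form_act (poly_form d c) g^-1%g + poly_form d c = 0.
  apply: cubic_light_eq0; first by rewrite cubicD ?cubic_act ?cubic_poly_form.
  by move=> w wl; rewrite ffunE [form_act _ _ _]ffunE invgK fixc // addFF.
have /eqP : poly_form d c (v *m glmx g) + poly_form d c v = 0.
  have := congr1 (fun f : F2fun d => f v) R0.
  by rewrite ffunE [form_act _ _ _]ffunE invgK => ->; rewrite ffunE.
by rewrite addr_eq0 F2_opp => /eqP.
Qed.

Theorem orbit_count C : count_ok d C ->
  bin_of_nat #|orbit form_action GL @: cubics| = C.
Proof.
case/and5P => ok keys ord tot /N.eqb_eq cnt.
have := Frobenius_Cauchy GL_acts_cubics.
rewrite (GL_sum ok keys ord tot) => [orb|a b]; last first.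
  rewrite -[RHS](card_imset _ (act_inj form_action b)); apply: eq_card => P.
  apply/setIP/imsetP => [[cP /afix1P fixP]|[R /setIP[cR /afix1P fixR] ->]].
    exists (form_action P b^-1%g); last by rewrite actKV.
    rewrite inE; apply/andP; split; first by rewrite !inE in cP *; apply: cubic_act.
    by apply/afix1P; rewrite -actM -[in RHS]fixP -actM conjgE !mulgA mulgK.
  split; first by rewrite !inE in cR *; apply: cubic_act.
  by apply/afix1P; rewrite -actM conjgE !mulgA mulgV mul1g actM fixR.
suff -> : #|orbit form_action GL @: cubics| = nat_of_bin C by rewrite nat_of_binK.
apply/eqP; rewrite -(eqn_pmul2r (cardG_gt0 GL)) -orb -nat_of_GL_order -nat_of_mul_bin.
rewrite -cnt nat_of_N_sum big_map; apply/eqP.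
have: all (datum_ok d) (class_data d) by [].
elim: (class_data d) => [|x xs IH]; rewrite ?big_nil // !big_cons /= => /andP[okx /IH ->].
rewrite nat_of_mul_bin nat_of_pow2; congr (_ * _ + _)%N.
by have [sA rA nA _ _] := datum_okP okx; rewrite fix_dim_correct.
Qed.

End Orbits.

(** * Isomorphism of loops with cubic forms *)

Definition sym_cocycle d (D : 'rV['F_2]_d -> 'rV['F_2]_d -> 'F_2) : Prop :=
  [/\ forall u, D u u = 0, forall u v, D u v = D v u
    & forall u v w, D u v + D (u + v) w + D v w + D u (v + w) = 0].

Lemma rvFF d (u : 'rV['F_2]_d) : u + u = 0.
Proof. by apply/rowP => i; rewrite !mxE addFF. Qed.

Lemma sym_cocycle0 d D : @sym_cocycle d D -> forall u, D 0 u = 0.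
Proof.
case=> D1 _ D3 u; have := D3 0 0 u; rewrite !add0r D1 => <-; F2_ring.
Qed.

(** Such a cocycle defines an elementary abelian extension, which splits.  The
    splitting is built one coordinate at a time: after [D] is corrected by the
    coboundary of [h], it vanishes on the hyperplane [s _], on the line [e _] and
    between the two, and the cocycle identity propagates this everywhere. *)
Lemma sym_cocycle_coboundary d D : @sym_cocycle d D ->
  exists h : 'rV['F_2]_d -> 'F_2, forall u v, D u v = h u + h v + h (u + v).
Proof.
elim: d D => [|d IH]; last rewrite -[d.+1]add1n; move=> D DC.
  exists (fun=> 0) => u v; rewrite [u]thinmx0 [v]thinmx0 sym_cocycle0 //; ring.
pose e (x : 'rV['F_2]_1) : 'rV['F_2]_(1 + d) := row_mx x 0.
pose s (v : 'rV['F_2]_d) : 'rV['F_2]_(1 + d) := row_mx 0 v.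
have sD u v : s (u + v) = s u + s v by rewrite /s add_row_mx addr0.
have eD u v : e (u + v) = e u + e v by rewrite /e add_row_mx addr0.
have s0 : s 0 = 0 by rewrite /s row_mx0.
have e0 : e 0 = 0 by rewrite /e row_mx0.
have dec (u : 'rV['F_2]_(1 + d)) : u = e (lsubmx u) + s (rsubmx u).
  by rewrite /e /s add_row_mx addr0 add0r hsubmxK.
have D0 := sym_cocycle0 DC; case: (DC) => D1 D2 D3.
have [h0 Hh0] : exists h : 'rV['F_2]_d -> 'F_2,
    forall u v, D (s u) (s v) = h u + h v + h (u + v).
  apply: (IH (fun u v => D (s u) (s v))); split=> [u|u v|u v w] //.
  by rewrite !sD.
have h00 : h0 0 = 0 by have := Hh0 0 0; rewrite addr0 D1 addFF add0r.
pose h (u : 'rV['F_2]_(1 + d)) := h0 (rsubmx u) + D (e (lsubmx u)) (s (rsubmx u)).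
pose D' u v := D u v + h u + h v + h (u + v).
have h_0 : h 0 = 0 by rewrite /h !linear0 h00 e0 s0 D0 addr0.
have D'1 u : D' u u = 0 by rewrite /D' rvFF D1 h_0; F2_ring.
have D'2 u v : D' u v = D' v u by rewrite /D' D2 [v + u]addrC; ring.
have D'3 u v w : D' u v + D' (u + v) w + D' v w + D' u (v + w) = 0.
  rewrite -[RHS](D3 u v w) /D' [u + (v + w)]addrA; F2_ring.
have D'C : sym_cocycle D' by split.
have D'0 u : D' 0 u = 0 := sym_cocycle0 D'C u.
have lse v : lsubmx (s v) = 0 by rewrite row_mxKl.
have rss v : rsubmx (s v) = v by rewrite row_mxKr.
have lee v : lsubmx (e v) = v by rewrite row_mxKl.
have ree v : rsubmx (e v) = 0 by rewrite row_mxKr.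
have D'ss u v : D' (s u) (s v) = 0.
  by rewrite /D' /h !linearD /= !lse !rss Hh0 addr0 e0 !D0; F2_ring.
have D'es x v : D' (e x) (s v) = 0.
  rewrite /D' /h !linearD /= !lse !rss !lee !ree addr0 add0r e0 s0 D0 h00 [D _ 0]D2 D0.
  F2_ring.
have D'es_s x u v : D' (e x + s u) (s v) = 0.
  by have := D'3 (e x) (s u) (s v); rewrite -sD !D'es D'ss !add0r !addr0.
have D'ee x y : D' (e x) (e y) = 0.
  have rv1 (z : 'rV['F_2]_1) : z = 0 \/ z = const_mx 1.
    by case: (F2_cases (z 0 0)) => z0; [left|right]; apply/rowP => i; rewrite ord1 z0 mxE.
  case: (rv1 x) (rv1 y) => -> [] ->; rewrite ?e0 ?D'0 //.
  by rewrite D'2 D'0.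
exists h => u v; have: D' u v = 0.
  rewrite (dec u) (dec v).
  set x := lsubmx u; set y := lsubmx v; set a := rsubmx u; set b := rsubmx v.
  have ay : D' (e x + s a) (e y) = 0.
    rewrite D'2; have := D'3 (e y) (e x) (s a).
    by rewrite -eD D'ee !D'es !add0r.
  have := D'3 (e x + s a) (e y) (s b).
  have -> : e x + s a + e y = e (x + y) + s a by rewrite eD addrAC.
  by rewrite ay D'es_s D'es !add0r.
by move/eqP; rewrite /D' -!addrA addr_eq0 F2_opp => /eqP.
Qed.

(** The conditions on a factor set, read on [F_2 ^ d] and expressed by [P] alone. *)
Definition factor_system d (P : F2fun d) (th : 'rV['F_2]_d -> 'rV['F_2]_d -> 'F_2) : Prop :=
  [/\ forall u, th u u = P u, forall u v, th u v + th v u = pol2 P u v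
    & forall u v w, th u v + th (u + v) w + th v w + th u (v + w) = pol3 P u v w].

Definition pair_mul d (th : 'rV['F_2]_d -> 'rV['F_2]_d -> 'F_2)
    (x y : 'F_2 * 'rV['F_2]_d) : 'F_2 * 'rV['F_2]_d :=
  (x.1 + y.1 + th x.2 y.2, x.2 + y.2).

Lemma glmx_exists n (M : 'M['F_2]_n.+1) :
  (forall v : 'rV_n.+1, v *m M = 0 -> v = 0) -> exists g : {'GL_n.+1['F_2]}, glmx g = M.
Proof.
move=> kerM; have := val_insubd (1%g : {'GL_n.+1['F_2]}) M.
suff -> : M \is a GRing.unit by exists (insubd (1%g : {'GL_n.+1['F_2]}) M).
by rewrite -[_ \is a _]row_free_unit; apply: inj_row_free.
Qed.

Lemma factor_system0 d (P : F2fun d) th : factor_system P th ->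
  P 0 = 0 /\ forall u, th 0 u = 0.
Proof.
case=> A1 A2 A3.
have P0 : P 0 = 0.
  have := A3 0 0 0; rewrite /pol3 !addr0.
  by case: (F2_cases (P 0)) (F2_cases (th 0 0)) => -> // [] -> /eqP.
split=> // u; have := A3 0 0 u; rewrite /pol3 !add0r A1 P0 => eq.
transitivity (0 + th 0 u + th 0 u + th 0 u); first by F2_ring.
rewrite eq; F2_ring.
Qed.

Section Isomorphism.
Variables (n : nat).
Local Notation d := n.+1.
Variables (P P' : F2fun d) (th th' : 'rV['F_2]_d -> 'rV['F_2]_d -> 'F_2).
Hypotheses (thP : factor_system P th) (thP' : factor_system P' th').

(** The two factor systems, compared along [g], differ by a symmetric cocycle with
    zero diagonal; a function [h] of which it is the coboundary corrects the first
    component of the isomorphism. *)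
Lemma factor_system_unique (g : {'GL_d['F_2]}) :
  (forall u, P' (u *m glmx g) = P u) ->
  exists2 f : 'F_2 * 'rV['F_2]_d -> 'F_2 * 'rV['F_2]_d,
    bijective f & {morph f : x y / pair_mul th x y >-> pair_mul th' x y}.
Proof.
move=> Pg; case: thP thP' => A1 A2 A3 [B1 B2 B3].
pose D u v := th u v + th' (u *m glmx g) (v *m glmx g).
have [|h Hh] := @sym_cocycle_coboundary d D.
  split=> [u|u v|u v w]; rewrite /D.
  - by rewrite A1 B1 Pg addFF.
  - have e2 : pol2 P' (u *m glmx g) (v *m glmx g) = pol2 P u v.
      by rewrite /pol2 -mulmxDl !Pg.
    apply/eqP; rewrite -subr_eq0; apply/eqP.
    rewrite -[RHS](addFF (pol2 P u v)) -{1}A2 -e2 -B2; F2_ring.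
  - have e3 : pol3 P' (u *m glmx g) (v *m glmx g) (w *m glmx g) = pol3 P u v w.
      by rewrite /pol3 -!mulmxDl !Pg.
    rewrite -[RHS](addFF (pol3 P u v w)) -{1}A3 -e3 -B3 !mulmxDl; F2_ring.
exists (fun x => (x.1 + h x.2, x.2 *m glmx g)).
  exists (fun x => (x.1 + h (x.2 *m glmx g^-1%g), x.2 *m glmx g^-1%g)) => -[a u] /=.
    by rewrite -mulmxA glmxK mulmx1 -addrA addFF addr0.
  by rewrite -mulmxA glmxVK mulmx1 -addrA addFF addr0.
move=> [a u] [b v] /=; rewrite /pair_mul /= mulmxDl; congr (_, _).
have -> : h (u + v) = D u v + h u + h v by rewrite Hh; F2_ring.
rewrite /D; F2_ring.
Qed.

(** All squares have the form [(P u, 0)].  If [P] vanishes, all squares are trivial in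
    both loops and [P'] vanishes too.  Otherwise [(1, 0)] is a square, [f] fixes it,
    and [f] induces an additive bijection [G] of the second components; comparing
    squares gives [P' (G u) = P u]. *)
Lemma forms_equivalent (f : 'F_2 * 'rV['F_2]_d -> 'F_2 * 'rV['F_2]_d) :
  bijective f -> {morph f : x y / pair_mul th x y >-> pair_mul th' x y} ->
  exists g : {'GL_d['F_2]}, forall u, P' (u *m glmx g) = P u.
Proof.
move=> bij_f fM; have inj_f := bij_inj bij_f.
case: (thP) => A1 A2 A3; case: (thP') => B1 B2 B3.
have [P0 th0u] := factor_system0 thP.
have [P'0 th'0u] := factor_system0 thP'.
have sq x : pair_mul th x x = (P x.2, 0) by rewrite /pair_mul A1 rvFF addFF add0r.
have sq' x : pair_mul th' x x = (P' x.2, 0) by rewrite /pair_mul B1 rvFF addFF add0r.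
have f0 : f (0, 0) = (0, 0).
  have := fM (0, 0) (0, 0); rewrite sq sq' /= P0.
  by case: (f (0, 0)) => c w [-> ->]; rewrite P'0.
case: (pickP (fun u => P u != 0)) => [u0 Pu0|allP0]; last first.
  exists 1%g => u; rewrite glmx1 mulmx1.
  have /eqP -> : P u == 0 by have := allP0 u => /negbFE.
  have [f' f'K fK] := bij_f.
  have := fM (f' (0, u)) (f' (0, u)); rewrite sq sq' !fK /=.
  by have := allP0 (f' (0, u)).2 => /negbFE/eqP ->; rewrite f0 => -[].
have fz a : f (a, 0) = (a, 0).
  case: (F2_cases a) => -> //.
  have := fM (0, u0) (0, u0); rewrite sq sq' /=.
  have -> : P u0 = 1 by case: (F2_cases (P u0)) Pu0 => ->.
  move=> f1; rewrite f1; case: (F2_cases (P' (f (0, u0)).2)) f1 => -> // f1.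
  by have := inj_f (1, 0) (0, 0); rewrite f0 f1 => /(_ erefl) [].
pose G u := (f (0, u)).2.
have fE a u : (f (a, u)).2 = G u.
  have := fM (a, 0) (0, u); rewrite fz /pair_mul /= th0u !addr0 add0r => ->.
  by rewrite /= add0r.
have GD u v : G (u + v) = G u + G v.
  have := congr1 snd (fM (0, u) (0, v)).
  by rewrite /pair_mul /= fE.
have G0 : G 0 = 0 by rewrite /G f0.
have Ginj u : G u = 0 -> u = 0.
  move=> Gu; have : f (0, u) = f ((f (0, u)).1, 0).
    by rewrite fz [LHS]surjective_pairing -/(G u) Gu.
  by move/inj_f => [].
have PG u : P' (G u) = P u.
  by have := fM (0, u) (0, u); rewrite sq sq' fz => -[->].
pose M : 'M['F_2]_d := \matrix_i G (delta_mx 0 i).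
have GM u : u *m M = G u.
  rewrite mulmx_sum_row [in RHS](row_sum_delta u) (big_morph G GD G0).
  apply: eq_bigr => i _; rewrite rowK.
  by case: (F2_cases (u 0 i)) => ->; rewrite ?scale0r ?scale1r.
have [g gM] : exists g : {'GL_d['F_2]}, glmx g = M.
  apply: glmx_exists => v; rewrite GM; exact: Ginj.
by exists g => u; rewrite gM GM.
Qed.
End Isomorphism.

(** * The cubic form of a code loop *)

Definition has_form d (P : F2fun d) (Q : loopType) : Prop :=
  exists th, factor_system P th /\
  exists2 f : Q -> 'F_2 * 'rV['F_2]_d,
    bijective f & {morph f : x y / (x * y)%g >-> pair_mul th x y}.

Lemma hamming_weight_sum n (u : 'rV['F_2]_n) :
  hamming_weight u = (\sum_(i < n) (u 0 i != 0)%R)%N.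
Proof.
rewrite /hamming_weight -sum1_card big_mkcond; apply: eq_bigr => i _.
by rewrite inE; case: (_ != _).
Qed.

Lemma hamming_weightD n (u v : 'rV['F_2]_n) :
  (hamming_weight (u + v) + 2 * hamming_weight (coord_cap u v) =
   hamming_weight u + hamming_weight v)%N.
Proof.
rewrite !hamming_weight_sum big_distrr -!big_split /=; apply: eq_bigr => i _.
by rewrite !mxE; case: (F2_cases (u 0 i)) (F2_cases (v 0 i)) => -> [] ->.
Qed.

Lemma coord_capDl n (u v w : 'rV['F_2]_n) :
  coord_cap (u + v) w = coord_cap u w + coord_cap v w.
Proof. by apply/rowP => i; rewrite !mxE mulrDl. Qed.

Lemma natrF2_even m : (2 * m)%:R = 0 :> 'F_2.
Proof. by rewrite natrM F2_2 mul0r. Qed.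

Lemma odd_hamming_weightD n (u v : 'rV['F_2]_n) :
  (hamming_weight (u + v))%:R = (hamming_weight u)%:R + (hamming_weight v)%:R :> 'F_2.
Proof. by rewrite -natrD -hamming_weightD natrD natrF2_even addr0. Qed.

Section DoublyEven.
Variables (n : nat) (V : {vspace 'rV['F_2]_n}).
Hypothesis evenV : doubly_even V.
Let q (u : 'rV['F_2]_n) : 'F_2 := (hamming_weight u %/ 4)%:R.

(** Divide [|u + v| + 2 |u cap v| = |u| + |v|] by 4. *)
Lemma weight_cap u v : u \in V -> v \in V ->
  (2 %| hamming_weight (coord_cap u v))%N /\
  (hamming_weight (coord_cap u v) %/ 2)%:R = q (u + v) + q u + q v.
Proof.
move=> uV vV; have := hamming_weightD u v; rewrite /q.
have /dvdnP[a ->] := evenV uV; have /dvdnP[b ->] := evenV vV.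
have /dvdnP[c ->] := evenV (memvD uV vV); rewrite !mulnK // => E.
have capE : hamming_weight (coord_cap u v) = ((a + b - c) * 2)%N.
  apply/eqP; rewrite -(eqn_pmul2l (isT : 0 < 2)%N); apply/eqP.
  rewrite mulnCA -[(2 * 2)%N]/4%N mulnBl mulnDl -E addKn //.
rewrite capE dvdn_mull // mulnK //; split=> //.
have le_c : (c <= a + b)%N.
  by rewrite -(leq_pmul2r (isT : 0 < 4)%N) mulnDl -E leq_addr.
have := congr1 (fun m => m%:R : 'F_2) (subnK le_c); rewrite !natrD => eq.
by rewrite -addrA -eq; F2_ring.
Qed.

(** As [u cap w] and [v cap w] intersect in [u cap v cap w] and add up to
    [(u + v) cap w], their weights give the triple intersection once more. *)
Lemma weight_cap3 u v w : u \in V -> v \in V -> w \in V ->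
  (hamming_weight (coord_cap (coord_cap u v) w))%:R =
  q (u + v + w) + q (u + v) + q (u + w) + q (v + w) + q u + q v + q w.
Proof.
move=> uV vV wV.
have := hamming_weightD (coord_cap u w) (coord_cap v w).
have [/dvdnP[a capa] ea] := weight_cap uV wV.
have [/dvdnP[b capb] eb] := weight_cap vV wV.
have [/dvdnP[c capc] ec] := weight_cap (memvD uV vV) wV.
rewrite -coord_capDl.
have -> : coord_cap (coord_cap u w) (coord_cap v w) = coord_cap (coord_cap u v) w.
  apply/rowP => i; rewrite !mxE.
  by case: (F2_cases (u 0 i)) (F2_cases (v 0 i)) (F2_cases (w 0 i)) => -> [] -> [] ->;
    rewrite ?(mulr0, mul0r, mulr1).
rewrite capa capb capc in ea eb ec *; rewrite !mulnK // in ea eb ec.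
rewrite [(2 * _)%N]mulnC -!mulnDl => /eqP; rewrite eqn_mul2r /= => /eqP E.
have := congr1 (fun m => m%:R : 'F_2) E; rewrite !natrD ea eb ec => e.
move/eqP: e; rewrite -subr_eq0 => /eqP e.
by apply/eqP; rewrite -subr_eq0; apply/eqP; rewrite -[RHS]e; F2_ring.
Qed.

End DoublyEven.

Lemma has_form_order d (P : F2fun d) Q : has_form P Q -> has_order Q (2 ^ d.+1).
Proof.
case=> th [_ [f [f' fK f'K] _]].
have cardE : #|{: 'F_2 * 'rV['F_2]_d}| = (2 ^ d.+1)%N.
  by rewrite card_prod card_mx card_Fp // mul1n expnS.
exists (fun x => cast_ord cardE (enum_rank (f x))).
exists (fun i => f' (enum_val (cast_ord (esym cardE) i))) => [x|i].
  by rewrite cast_ordK enum_rankK fK.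
by rewrite f'K enum_valK cast_ordKV.
Qed.

(** The order of a loop determines the dimension of its code. *)
Lemma has_order_inj Q a b : has_order Q a -> has_order Q b -> a = b.
Proof.
case=> f [f' fK f'K] [g [g' gK g'K]].
rewrite -[a]card_ord -[b]card_ord; apply: (@bij_eq_card _ _ (g \o f')).
by exists (f \o g') => i /=; rewrite ?gK ?f'K // fK g'K.
Qed.

(** Triple intersections are additive modulo 2 in each argument, whence the
    trilinearity that makes [P] cubic. *)
Lemma code_loop_form Q : is_code_loop Q ->
  exists d (P : F2fun d), cubic P /\ has_form P Q.
Proof.
case=> n [V [th [evenV [f bij_f fM]]]].
pose d := dim (subvs_of V); pose phi (u : 'rV['F_2]_d) : subvs_of V := r2v (vT := subvs_of V) u.
have phiD u v : phi (u + v) = phi u + phi v by apply: linearD.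
pose P : F2fun d := [ffun u => (hamming_weight (vsval (phi u)) %/ 4)%:R].
have phi2 u v : vsval (phi (u + v)) = vsval (phi u) + vsval (phi v) by rewrite phiD.
have Vphi u : vsval (phi u) \in V := subvsP _.
have pol3E u v w : pol3 P u v w = (hamming_weight
    (coord_cap (coord_cap (vsval (phi u)) (vsval (phi v))) (vsval (phi w))))%:R.
  by rewrite (weight_cap3 evenV) // /pol3 !ffunE !phi2.
exists d, P; split.
  apply/cubicP; split=> [|u v w t].
    by rewrite ffunE /phi !linear0 hamming_weight0.
  by rewrite !pol3E phi2 !coord_capDl odd_hamming_weightD.
exists (fun u v => th (phi u) (phi v)); split.
  split=> [u|u v|u v w]; first by rewrite thetaxx ffunE.
    have [_ e] := weight_cap evenV (Vphi u) (Vphi v).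
    by rewrite thetaC e /pol2 !ffunE phi2.
  by rewrite !phiD thetaA pol3E.
exists (fun x => ((f x).1, v2r (f x).2)).
  have [f' fK f'K] := bij_f.
  exists (fun x => f' (x.1, phi x.2)) => [x|[a u]].
    by rewrite /= /phi v2rK -surjective_pairing fK.
  by rewrite f'K /= /phi r2vK.
move=> x y; rewrite fM -[(f x * f y)%g]/(code_mul (f x) (f y)) /code_mul /pair_mul /=.
by rewrite /phi !v2rK linearD.
Qed.

(** * Codes realizing a cubic function *)

Section Realization.
Variable d : nat.
Implicit Types (P : F2fun d) (s : seq 'cV['F_2]_d).

(** A code is given by the columns [s] of a generator matrix; this is the weight of
    the codeword of [u].  Juxtaposing two matrices adds the weights. *)
Definition column_weight s (u : 'rV['F_2]_d) : nat :=
  count (fun a => (u *m a) 0 0 != 0) s.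

Definition realizes s P : Prop :=
  forall u, exists2 k, column_weight s u = (4 * k)%N & k%:R = P u.

Lemma column_weight_cat s s' u :
  column_weight (s ++ s') u = (column_weight s u + column_weight s' u)%N.
Proof. exact: count_cat. Qed.

Lemma realizes0 : realizes [::] 0.
Proof. by move=> u; exists 0%N; rewrite ?ffunE. Qed.

Lemma realizesD s s' P P' : realizes s P -> realizes s' P' -> realizes (s ++ s') (P + P').
Proof.
move=> sP sP' u; have [k ck kP] := sP u; have [k' ck' kP'] := sP' u.
exists (k + k')%N; first by rewrite column_weight_cat ck ck' mulnDr.
by rewrite natrD kP kP' ffunE.
Qed.

(** The columns of the simplex code on three bits: a codeword has weight 4 unless
    all three bits vanish, so that [|u| / 4] is the disjunction of the bits. *)
Definition simplex3 (a b c : 'cV['F_2]_d) :=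
  [:: a; b; c; a + b; a + c; b + c; a + b + c].

(** Modulo 2, the product of three bits is the sum of the disjunctions of all
    nonempty subfamilies of them. *)
Definition coord3_columns (i j k : 'I_d) : seq 'cV['F_2]_d :=
  let a := delta_mx i 0 in let b := delta_mx j 0 in let c := delta_mx k 0 in
  simplex3 a b c ++ simplex3 a b 0 ++ simplex3 a c 0 ++ simplex3 b c 0 ++
  simplex3 a 0 0 ++ simplex3 b 0 0 ++ simplex3 c 0 0.

Lemma mulmx_delta0 (u : 'rV['F_2]_d) i : (u *m (delta_mx i 0 : 'cV_d)) 0 0 = u 0 i :> 'F_2.
Proof.
rewrite mxE (bigD1 i) //= big1 => [|j ji]; first by rewrite mxE !eqxx mulr1 addr0.
by rewrite mxE (negPf ji) mulr0.
Qed.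

Lemma mulmxD00 (u : 'rV['F_2]_d) (a b : 'cV['F_2]_d) :
  (u *m (a + b)) 0 0 = (u *m a) 0 0 + (u *m b) 0 0.
Proof. by rewrite mulmxDr mxE. Qed.

Lemma mulmx000 (u : 'rV['F_2]_d) : (u *m (0 : 'cV['F_2]_d)) 0 0 = 0.
Proof. by rewrite mulmx0 mxE. Qed.

Lemma simplex3_weight a b c u :
  column_weight (simplex3 a b c) u =
  (4 * (((u *m a) 0 0 != 0) || ((u *m b) 0 0 != 0) || ((u *m c) 0 0 != 0))%R)%N.
Proof.
rewrite /column_weight /= !mulmxD00.
by case: (F2_cases ((u *m a) 0 0)) (F2_cases ((u *m b) 0 0)) (F2_cases ((u *m c) 0 0))
  => -> [] -> [] ->.
Qed.

Lemma realizes_coord3 i j k : realizes (coord3_columns i j k) (coord3 i j k).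
Proof.
move=> u; rewrite ffunE !column_weight_cat !simplex3_weight !mulmx_delta0 !mulmx000.
case: (F2_cases (u 0 i)) (F2_cases (u 0 j)) (F2_cases (u 0 k)) => -> [] -> [] ->;
  (* One, two or three nonzero bits occur in 4, 6 or 7 of the disjunctions. *)
  [exists 0%N|exists 4%N|exists 4%N|exists 6%N|exists 4%N|exists 6%N|exists 6%N|exists 7%N];
  by [|apply/eqP].
Qed.

Lemma realizes_coord3_sum l :
  realizes (flatten [seq coord3_columns t.1.1 t.1.2 t.2 | t <- l]) (coord3_sum l).
Proof.
rewrite /coord3_sum; elim: l => [|t l IH]; rewrite ?big_nil ?big_cons; first exact: realizes0.
exact: realizesD (realizes_coord3 _ _ _) IH.
Qed.

(** Repeating every coordinate eight times does not affect weights modulo 8, and it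
    makes encoding injective. *)
Definition padding : seq 'cV['F_2]_d :=
  flatten (nseq 8 [seq delta_mx i 0 | i <- enum 'I_d]).

Lemma padding_weight u : column_weight padding u = (8 * hamming_weight u)%N.
Proof.
rewrite /column_weight /padding count_flatten map_nseq sumn_nseq mulnC; congr (_ * _)%N.
rewrite count_map -sum1_count big_mkcond big_enum hamming_weight_sum /=.
by apply: eq_bigr => i _; rewrite mulmx_delta0; case: (_ != _).
Qed.

Lemma realizes_padding : realizes padding 0.
Proof.
move=> u; exists (2 * hamming_weight u)%N; first by rewrite padding_weight mulnA.
by rewrite ffunE natrF2_even.
Qed.

Lemma realizes_inj P s : realizes s P -> exists2 s', realizes s' P &
  forall u, column_weight s' u = 0%N -> u = 0.
Proof.
move=> sP; exists (padding ++ s); first by rewrite -[P]add0r; apply: realizesD realizes_padding sP.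
move=> u /eqP; rewrite column_weight_cat addn_eq0 padding_weight muln_eq0 /= => /andP[/eqP u0 _].
apply/rowP => i; rewrite mxE; have := card0_eq u0 i; rewrite inE.
by move/negbFE/eqP.
Qed.

(** Among the terms of the expansion of [(x + x') (y + y') (z + z')], those with two
    unprimed factors; exchanging [u] and [v] gives those with one, and on the
    diagonal three equal terms add up to one. *)
Definition coord3_theta (i j k : 'I_d) (u v : 'rV['F_2]_d) : 'F_2 :=
  u 0 i * u 0 j * v 0 k + u 0 i * u 0 k * v 0 j + u 0 j * u 0 k * v 0 i.

Lemma factor_system_coord3 i j k :
  factor_system (coord3 i j k) (coord3_theta i j k).
Proof.
split=> [u|u v|u v w]; rewrite /coord3_theta ?pol3_coord3 ?big_cons ?big_nil /pol2 ?ffunE ?mxE /=;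
  F2_ring.
Qed.

Lemma factor_systemD P P' th th' : factor_system P th -> factor_system P' th' ->
  factor_system (P + P') (fun u v => th u v + th' u v).
Proof.
move=> [A1 A2 A3] [B1 B2 B3]; split=> [u|u v|u v w].
- by rewrite A1 B1 ffunE.
- have -> : pol2 (P + P') u v = pol2 P u v + pol2 P' u v by rewrite /pol2 !ffunE; ring.
  by rewrite -A2 -B2; ring.
have -> : pol3 (P + P') u v w = pol3 P u v w + pol3 P' u v w by rewrite /pol3 !ffunE; ring.
by rewrite -A3 -B3; ring.
Qed.

Lemma factor_system_sum l : exists th, factor_system (@coord3_sum d l) th.
Proof.
rewrite /coord3_sum; elim: l => [|t l [th IH]].
  exists (fun _ _ => 0); rewrite big_nil.
  by split=> *; rewrite /pol2 /pol3 ?ffunE ?addr0.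
rewrite big_cons; eexists; exact: factor_systemD (factor_system_coord3 _ _ _) IH.
Qed.

Lemma cubic_coord3P P : cubic P -> exists l, P = coord3_sum l.
Proof. by case/cubic_poly_formP => c _ ->; apply: poly_form_span. Qed.

Section CodeOfColumns.
Variables (P : F2fun d) (s : seq 'cV['F_2]_d).
Variable th : 'rV['F_2]_d -> 'rV['F_2]_d -> 'F_2.
Hypotheses (sP : realizes s P) (s_inj : forall u, column_weight s u = 0%N -> u = 0).
Hypothesis thP : factor_system P th.
Local Notation n := (size s).

Definition generator : 'M['F_2]_(d, n) := \matrix_(i, j) nth 0 s j i 0.

Lemma hamming_weight_generator u : hamming_weight (u *m generator) = column_weight s u.
Proof.
rewrite hamming_weight_sum /column_weight -sum1_count.
rewrite (big_nth 0) big_mkord [RHS]big_mkcond; apply: eq_bigr => j _.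
have -> : (u *m generator) 0 j = (u *m nth 0 s j) 0 0.
  by rewrite !mxE; apply: eq_bigr => i _; rewrite mxE.
by case: (_ != _).
Qed.

Definition encode : 'Hom('rV['F_2]_d, 'rV['F_2]_n) := linfun (mulmxr generator).
Definition code : {vspace 'rV['F_2]_n} := limg encode.

Lemma encodeE u : encode u = u *m generator.
Proof. by rewrite lfunE. Qed.

Lemma encode_ker : lker encode == 0%VS.
Proof.
apply/lker0P => u v; rewrite !encodeE => uv; apply/eqP; rewrite -subr_eq0; apply/eqP/s_inj.
by rewrite -hamming_weight_generator mulmxBl uv subrr hamming_weight0.
Qed.

Definition decode (x : subvs_of code) : 'rV['F_2]_d := (encode^-1)%VF (vsval x).

Lemma decodeK x : encode (decode x) = vsval x.
Proof. exact: limg_lfunVK (subvsP x). Qed.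

Lemma decodeD x y : decode (x + y) = decode x + decode y.
Proof. by rewrite /decode !linearD. Qed.

Lemma code_doubly_even : doubly_even code.
Proof.
move=> _ /memv_imgP[u _ ->]; rewrite encodeE hamming_weight_generator.
by have [k -> _] := sP u; rewrite dvdn_mulr.
Qed.

Lemma code_weight x : (hamming_weight (vsval x) %/ 4)%:R = P (decode x).
Proof.
rewrite -decodeK encodeE hamming_weight_generator.
by have [k -> <-] := sP (decode x); rewrite mulKn.
Qed.

Definition code_factor_set : factor_set code.
Proof.
exists (fun x y => th (decode x) (decode y)) => [x|x y|x y z]; case: thP => A1 A2 A3.
- by rewrite A1 code_weight.
- have [_ ->] := weight_cap code_doubly_even (subvsP x) (subvsP y).
  by rewrite A2 /pol2 -decodeD -!code_weight linearD.
rewrite (weight_cap3 code_doubly_even) ?subvsP // !decodeD A3 /pol3.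
by rewrite -!decodeD -!code_weight !linearD.
Defined.

Lemma code_factor_set_form : has_form P (code_loop code_factor_set).
Proof.
exists th; split=> //; exists (fun x => (x.1, decode x.2)).
  exists (fun x => (x.1, vsproj code (encode x.2))) => -[a u] /=.
    by rewrite decodeK vsvalK.
  rewrite /decode vsprojK ?memv_img ?memvf //.
  by rewrite (lker0_lfunK encode_ker).
move=> x y; rewrite -[(x * y)%g]/(code_mul x y) /code_mul /pair_mul /=.
by rewrite decodeD.
Qed.

End CodeOfColumns.

Lemma cubic_code_loop P : cubic P -> exists Q, is_code_loop Q /\ has_form P Q.
Proof.
move=> /cubic_coord3P[l ->].
have [s sP s_inj] := realizes_inj (realizes_coord3_sum l).
have [th thP] := factor_system_sum l.
exists (code_loop (code_factor_set sP thP)); split.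
  exists (size s), (code s), (code_factor_set sP thP); split; first exact: code_doubly_even.
  by exists id => //; exists id.
exact: code_factor_set_form.
Qed.

End Realization.

(** * Counting *)

Section Count.
Variable n : nat.
Local Notation d := n.+1.
Local Notation GL := 'GL_d['F_2]%G.

(** Both directions pass to the coordinates [F_2 * F_2 ^ d] of the two loops. *)
Lemma isog_forms (P P' : F2fun d) (Q Q' : loopType) :
  has_form P Q -> has_form P' Q' ->
  loop_isog Q Q' <-> P' \in orbit (form_action n) GL P.
Proof.
move=> [th [thP [f bij_f fM]]] [th' [thP' [f' bij_f' fM']]].
have [fi fK fiK] := bij_f; have [fi' fK' fiK'] := bij_f'.
have fiM : {morph fi : x y / pair_mul th x y >-> (x * y)%g}.
  by move=> x y; apply: (bij_inj bij_f); rewrite fM !fiK.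
have fiM' : {morph fi' : x y / pair_mul th' x y >-> (x * y)%g}.
  by move=> x y; apply: (bij_inj bij_f'); rewrite fM' !fiK'.
split=> [[h bij_h hM]|/orbitP[g _ gP]].
  have [||g gP] := @forms_equivalent _ _ _ _ _ thP thP' (f' \o h \o fi).
  - by apply: bij_comp; [apply: bij_comp | exists f].
  - by move=> x y /=; rewrite fiM hM fM'.
  apply/orbitP; exists g; rewrite ?inE //.
  by apply/ffunP => v; rewrite ffunE -gP -mulmxA glmxVK mulmx1.
have [|h bij_h hM] := factor_system_unique thP thP' (g := g).
  by move=> u; rewrite -gP ffunE -mulmxA glmxK mulmx1.
exists (fi' \o h \o f); last by move=> x y /=; rewrite fM hM fiM'.
by apply: bij_comp; [apply: bij_comp => //; exists f' | ].
Qed.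

(** One code loop is chosen for each orbit of cubic functions. *)
Theorem code_loops_counted C : count_ok d C -> code_loops_up_to_isog (2 ^ d.+1) C.
Proof.
move=> /orbit_count; set O := _ @: _ => cardO.
pose represents (i : 'I_#|O|) (Q : loopType) := is_code_loop Q /\
  exists2 P, has_form P Q & enum_val i = orbit (form_action n) GL P.
have [L HL] : exists L : 'I_#|O| -> loopType, forall i, represents i (L i).
  apply: (@fin_all_exists _ (fun=> loopType) represents) => i; have /imsetP[P cP Pi] := enum_valP i.
  have [|Q [Qcode QP]] := @cubic_code_loop d P; first by rewrite inE in cP.
  by exists Q; split=> //; exists P.
exists 'I_#|O|, L; split=> [|i|Q ordQ codeQ]; first by rewrite card_ord.
  by have [codeL [P LP _]] := HL i; split=> //; apply: has_form_order LP.
have [k [P [cP QP]]] := code_loop_form codeQ.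
have kd : k = d.
  have := has_order_inj (has_form_order QP) ordQ.
  by move/eqP; rewrite eqn_exp2l // => /eqP [].
subst k.
have PO : orbit (form_action n) GL P \in O by apply: imset_f; rewrite inE.
have iE := enum_rankK_in PO PO.
set i := enum_rank_in PO _ in iE.
exists i; split.
  have [_ [P' LP' orbE]] := HL i.
  by apply/(isog_forms QP LP'); rewrite -iE orbE orbit_refl.
move=> j isoj; have [_ [P' LP' orbE]] := HL j.
have P'P := (isog_forms QP LP').1 isoj.
by apply: enum_val_inj; rewrite iE orbE; apply/esym/orbit_eqP.
Qed.

End Count.

Lemma count_ok_6 : count_ok 6 767%num.
Proof. by vm_compute. Qed.
Lemma count_ok_7 : count_ok 7 80826%num.
Proof. by vm_compute. Qed.
Lemma count_ok_8 : count_ok 8 937791557%num.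
Proof. by vm_compute. Qed.

Theorem mainTheorem1 :
  code_loops_up_to_isog 128 767%num /\
  code_loops_up_to_isog 256 80826%num /\
  code_loops_up_to_isog 512 937791557%num.
Proof.
split; first exact: (code_loops_counted count_ok_6).
split; first exact: (code_loops_counted count_ok_7).
exact: (code_loops_counted count_ok_8).
Qed.
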